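(* Let $1\le k\le n$ and let $\gamma_n^k$ be the total space of the canonical vector bundle over the Grassmannian $G_n^k$ of $k$-dimensional linear subspaces of $\mathbb R^n$, equipped with a norm on each fiber which has a smooth unit ball and depends continuously on the fiber. Let $V_1,\dots,V_{n+1}\subseteq\gamma_n^k$ be compact sets such that for every $i$ and every $L\in G_n^k$ the intersection $V_i\cap L$ with the fiber over $L$ is non-empty and depends continuously on $L$ in the Hausdorff metric. Suppose that for every $L\in G_n^k$ the family $\{V_i\cap L\}_{i=1}^{n+1}$ is non-antipodal in $L$. Then there exist $L\in G_n^k$ and a point $x\in L$ such that the distances (in the norm of $L$) from $x$ to the sets $V_i\cap L$, $i=1,\dots,n+1$, are all equal.
   Context: The fiber of $\gamma_n^k$ over $L$ is identified with the vector space $L$. For a convex compact set $K$ in a finite-dimensional real vector space, two points of $\partial K$ are called antipodal with respect to $K$ if they lie in a pair of supporting hyperplanes of $K$ with opposite outer normals (equivalently, the segment between them is an affine diameter of $K$). A family $\mathcal F$ of compact sets is called non-antipodal if no set $V\in\mathcal F$ contains a pair of points antipodal with respect to $\operatorname{conv}\bigcup\mathcal F$. *)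

(* Defs.v *)
From HB Require Import structures.
From mathcomp Require Import all_boot all_order all_algebra.
From mathcomp Require Import all_classical all_reals all_analysis.

Set Implicit Arguments.
Unset Strict Implicit.
Unset Printing Implicit Defensive.

Import Order.TTheory GRing.Theory Num.Theory.
Import numFieldNormedType.Exports.

Local Open Scope classical_set_scope.
Local Open Scope ring_scope.

(** ** Convex bodies in a linear subspace [L] of [E] *)

Section ConvexBodies.
Context {R : realType} {E : vectType R}.
Implicit Types (L : {vspace E}) (A K : set E) (f : {scalar E}) (c : R).

Definition convex_hull A : set E :=
  \bigcap_(C in [set C : set E | @convex_set R E C /\ A `<=` C]) C.

(* [f x = c] is the equation of a supporting hyperplane of [K] in [L], and
   [f] restricted to [L] is its outer normal.  Every linear form on [L] is the
   restriction of some [f : {scalar E}].  A hyperplane that contains the whole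
   of [K] counts as supporting. *)
Definition supporting L K f c :=
  [/\ exists2 v, v \in L & f v != 0,
      forall x, K x -> f x <= c
    & exists2 x, K x & f x = c].

Definition hyperplane L f c : set E := [set x | x \in L /\ f x = c].

End ConvexBodies.

Section Boundary.
Context {R : realType} {n : nat}.
Implicit Types (L : {vspace 'rV[R]_n}) (K : set 'rV[R]_n).

(* The boundary of [K] relative to [L]; [L] is closed in [R^n], so closures in
   [L] are closures in [R^n]. *)
Definition boundary L K : set 'rV[R]_n :=
  closure K `&` closure ([set` L] `\` K).

(* The points need not be distinct: if [K] lies in a hyperplane of [L], that
   hyperplane supports [K] with both of its normals, so that any [p] in [K] is
   antipodal to itself. *)
Definition antipodal L K (p q : 'rV[R]_n) :=
  [/\ boundary L K p, boundary L K q
    & exists (f : {scalar 'rV[R]_n}) (a b : R),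
      [/\ supporting L K f a, supporting L K (\- f) b,
          hyperplane L f a p & hyperplane L (\- f) b q]].

Definition non_antipodal (I : Type) L (F : I -> set 'rV[R]_n) :=
  forall i p q, F i p -> F i q ->
    ~ antipodal L (convex_hull (\bigcup_j F j)) p q.

(* Smoothness in the sense of convex geometry: there is only one supporting
   hyperplane through each boundary point. *)
Definition smooth_body L K :=
  forall p, boundary L K p ->
  forall (f g : {scalar 'rV[R]_n}) (a b : R),
    supporting L K f a -> hyperplane L f a p ->
    supporting L K g b -> hyperplane L g b p ->
    hyperplane L f a = hyperplane L g b.

End Boundary.

(** ** Norms on a subspace; distances *)

Section Norms.
Context {R : realType} {E : vectType R}.
Implicit Types (L : {vspace E}) (N : E -> R) (A : set E).

(* The values of [N] outside [L] are irrelevant. *)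
Definition norm_on L N :=
  [/\ forall v, v \in L -> 0 <= N v,
      forall v, v \in L -> N v = 0 -> v = 0,
      forall (a : R) v, v \in L -> N (a *: v) = `|a| * N v
    & forall v w, v \in L -> w \in L -> N (v + w) <= N v + N w].

Definition unit_ball L N : set E := [set v | v \in L /\ N v <= 1].

Definition dist_to N (x : E) A : R := inf [set N (x - y) | y in A].

End Norms.

(* For non-empty bounded sets.  On row vectors, [ball] is that of the maximum
   norm; all norms on [R^n] give equivalent Hausdorff distances. *)
Definition hausdorff_dist {R : realType} {T : pseudoMetricType R}
    (A B : set T) : R :=
  inf [set e : R | [/\ 0 < e, A `<=` \bigcup_(b in B) ball b e
                             & B `<=` \bigcup_(a in A) ball a e]].

(** ** Grassmannian and canonical bundle *)

Section OrthogonalProjection.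
Context {R : realType} {n : nat}.
Implicit Types (L : {vspace 'rV[R]_n}).

Definition basis_mx L : 'M[R]_(\dim L, n) := \matrix_(i < \dim L) (vbasis L)`_i.

(* Matrices act on row vectors from the right; the usual [A (A^T A)^-1 A^T]
   for a matrix [A] whose columns form a basis of [L]. *)
Definition orth_proj L : 'M[R]_n :=
  let B := basis_mx L in B^T *m invmx (B *m B^T) *m B.

Lemma mem_basis_mx L (x : 'rV[R]_n) :
  reflect (exists c : 'rV_(\dim L), x = c *m basis_mx L) (x \in L).
Proof.
have sumE (c : 'rV_(\dim L)) :
    c *m basis_mx L = \sum_(i < \dim L) c 0 i *: (vbasis L)`_i.
  by rewrite mulmx_sum_row; apply: eq_bigr => i _; rewrite rowK.
apply: (iffP idP) => [xL|[c ->]]; last first.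
  rewrite sumE; apply: memv_suml => i _; apply: memvZ.
  by apply: vbasis_mem; rewrite mem_nth ?size_tuple.
exists (\row_i coord (vbasis L) i x); rewrite sumE {1}(coord_vbasis xL).
by apply: eq_bigr => i _; rewrite mxE.
Qed.

Lemma gram_basis_mx_unit L : basis_mx L *m (basis_mx L)^T \in unitmx.
Proof.
set B := basis_mx L.
rewrite -row_free_unit -kermx_eq0; apply/eqP/row_matrixP => i.
rewrite row0; set u := row i _.
have uBB : u *m (B *m B^T) = 0 by rewrite -row_mul mulmx_ker row0.
have : (u *m B) *m (u *m B)^T = 0.
  by rewrite trmx_mul !mulmxA -(mulmxA u) uBB mul0mx.
move=> /matrixP/(_ 0 0); rewrite !mxE => /eqP.
rewrite psumr_eq0 => [/allP sq0|j _]; last first.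
  by rewrite [X in _ * X]mxE -expr2 sqr_ge0.
have uB0 : u *m B = 0.
  apply/rowP => j; rewrite [RHS]mxE; apply/eqP.
  by have := sq0 j (mem_index_enum _); rewrite [X in _ * X]mxE -expr2 sqrf_eq0.
move: uB0; rewrite mulmx_sum_row.
under eq_bigr => j _ do rewrite rowK.
have /freeP bfree := basis_free (vbasisP L).
by move=> /bfree u0; apply/rowP => j; rewrite u0 mxE.
Qed.

Lemma orth_projP L (x : 'rV[R]_n) :
  x *m orth_proj L \in L /\
  forall y, y \in L -> (x - x *m orth_proj L) *m y^T = 0.
Proof.
rewrite /orth_proj /=; split.
  by apply/mem_basis_mx; rewrite !mulmxA; eexists; reflexivity.
move=> y /mem_basis_mx[c ->]; rewrite trmx_mul (mulmxA _ _ c^T) mulmxBl.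
set B := basis_mx L; set G := B *m B^T.
have -> : x *m (B^T *m invmx G *m B) *m B^T = x *m B^T *m (invmx G *m G).
  by rewrite /G !mulmxA.
by rewrite mulVmx ?gram_basis_mx_unit// mulmx1 subrr mul0mx.
Qed.

End OrthogonalProjection.

Definition subspaces (R : realType) (n k : nat) : Type :=
  {L : {vspace 'rV[R]_n} | \dim L == k}.
HB.instance Definition _ R n k := Choice.on (subspaces R n k).

(* The usual topology of the Grassmannian, induced by the metric
   [|orth_proj L - orth_proj M|]. *)
Definition grassmannian (R : realType) (n k : nat) : Type :=
  initial_topology (fun L : subspaces R n k => orth_proj (val L)).
HB.instance Definition _ R n k := PseudoMetric.on (grassmannian R n k).

Definition subspace_of {R : realType} {n k : nat} (L : grassmannian R n k) :
  {vspace 'rV[R]_n} := val (L : subspaces R n k).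

Section CanonicalBundle.
Context {R : realType} {n k : nat}.

(* The total space, with the topology induced by that of the product. *)
Definition canonical_bundle : set (grassmannian R n k * 'rV[R]_n) :=
  [set p | p.2 \in subspace_of p.1].

Definition fiber_over (V : set (grassmannian R n k * 'rV[R]_n))
    (L : grassmannian R n k) : set 'rV[R]_n := [set v | V (L, v)].

End CanonicalBundle.

(* Main.v *)
(** The distance functions are compared at infinity.  Let [N] be the norm of the
    fibre [L], let [u] be a non-zero vector of [L], and let [f] be the linear form
    supporting the unit ball in the direction [u], which is unique by smoothness.
    As [r] grows, [N (r u) - dist (r u, V_i)] tends to the maximum of [f] on [V_i],
    locally uniformly in [u] and [L].  Choose [i] such that [V_i] contains a maximum
    point of [f] on the union of the family, and [j] such that [V_j] contains a
    minimum point.  By non-antipodality [V_i] contains no minimum point and [V_j] no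
    maximum point, so that for large [r] the set [V_i] is closer than [V_j] to [r u],
    and farther than [V_j] from [- r u].  Hence, if [g x] denotes the vector of the
    differences of the distances from [x], then [(1 - w) g (x) - w g (- x)] does not
    vanish for [x] large and [0 <= w <= 1]; it is odd in [x] for [w = 1/2].

    It remains to see that a map from the unit ball bundle to [R^n] that is odd on
    the boundary has a zero.  Restrict the bundle to the [k]-spaces [L] that contain
    a fixed subspace of dimension [k - 1]; they form a projective space, and the
    total space has dimension [n].  It is parametrized by the cube [-1, 1]^n, in such
    a way that opposite faces are either degenerate, or identified with each other,
    or identified up to the antipodal map.  Label each vertex of the barycentric
    subdivision of a fine grid by the largest component of the map and its sign.  As
    in Ky Fan's lemma, the parity of the number of alternating simplices is the same
    for the subcubes of all dimensions: it is odd for a point, and even for the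
    whole cube, since only [n] indices are available. *)

Require Import Defs.
From HB Require Import structures.
From mathcomp Require Import all_boot all_order all_algebra.
From mathcomp Require Import all_classical all_reals all_analysis.
From mathcomp Require Import zify ring lra.

Set Implicit Arguments.
Unset Strict Implicit.
Unset Printing Implicit Defensive.

Import Order.TTheory GRing.Theory Num.Theory.
Import numFieldNormedType.Exports.

Local Open Scope classical_set_scope.
Local Open Scope ring_scope.

(** * Parity of alternating simplices *)

(** Booleans form the field with two elements, so that sums of booleans are parities. *)
Lemma addbool2 (b : bool) : b + b = 0.
Proof. by case: b. Qed.

Section FaceSums.
Context {T : Type}.
Implicit Types (G : seq T -> bool) (s : seq T).

(** The parity of the number of positions of [s] whose deletion leaves a sequence satisfying [G]; if
    [s] lists the vertices of a simplex, these are its facets. *)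
Fixpoint face_sum G s : bool :=
  if s is x :: s' then G s' + face_sum (fun l => G (x :: l)) s' else 0.

Lemma eq_face_sum G G' s : G =1 G' -> face_sum G s = face_sum G' s.
Proof.
elim: s G G' => //= x s IH G G' e; rewrite e; congr (_ + _).
by apply: IH => l; rewrite e.
Qed.

Lemma face_sum0 s : face_sum (fun=> 0) s = 0.
Proof. by elim: s => //= x s ->. Qed.

(** A Leibniz rule: the deleted entry belongs to exactly one of the two subsequences. *)
Lemma face_sum_filter (p : pred T) (H : seq T -> seq T -> bool) s :
  face_sum (fun l => H (seq.filter p l) (seq.filter (predC p) l)) s =
    face_sum (fun l => H l (seq.filter (predC p) s)) (seq.filter p s) +
    face_sum (fun l => H (seq.filter p s) l) (seq.filter (predC p) s).
Proof.
elim: s H => //= x s IH H.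
case: (p x) => /=.
- by rewrite (IH (fun a b => H (x :: a) b)) addrA.
- by rewrite (IH (fun a b => H a (x :: b))) addrCA.
Qed.

End FaceSums.

Lemma face_sum_map (S T : Type) (f : S -> T) (G : seq T -> bool) s :
  face_sum (fun l => G (map f l)) s = face_sum G (map f s).
Proof. by elim: s G => //= x s IH G; rewrite -(IH (fun l => G (f x :: l))). Qed.

(** An index and a sign; in [sign_label] the sign [true] stands for a negative value. *)
Definition label := (nat * bool)%type.

Definition opp_label (l : label) : label := (l.1, ~~ l.2).

(* [alternates m i b s]: the labels of [s] with index in [i, i + m) have
   pairwise distinct indices, and their signs, by increasing index, are
   [b, ~~ b, b, ...]. *)
Fixpoint alternates (m i : nat) (b : bool) (s : seq label) : bool :=
  if m is m'.+1 then
    match seq.filter (fun l => l.1 == i) s with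
    | [::] => alternates m' i.+1 b (seq.filter (predC (fun l => l.1 == i)) s)
    | [:: l] => (l.2 == b) &&
        alternates m' i.+1 (~~ b) (seq.filter (predC (fun l => l.1 == i)) s)
    | _ => false
    end
  else true.

Lemma alternates_opp m i b s :
  alternates m i b (map opp_label s) = alternates m i (~~ b) s.
Proof.
elim: m i b s => //= m IH i b s.
have flt (p : pred nat) : seq.filter (fun l : label => p l.1) (map opp_label s) =
    map opp_label (seq.filter (fun l : label => p l.1) s).
  by rewrite filter_map; congr map.
rewrite (flt (fun j => j == i)) (flt (fun j => j != i)).
case: (seq.filter (fun l : label => l.1 == i) s) => [|l [|l' s']] //=.
by rewrite IH; case: (l.2); case: b.
Qed.

Lemma alternates_size m i b s :
  all (fun l => i <= l.1 < i + m)%N s -> alternates m i b s -> (size s <= m)%N.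
Proof.
elim: m i b s => [|m IH] i b s /=.
  by case: s => //= l s; rewrite addn0 ltnNge => /andP[/andP[->]].
move=> /allP sP.
have := count_predC (fun l : label => l.1 == i) s; rewrite -!size_filter => <-.
have {}IH b' := IH i.+1 b' (seq.filter (predC (fun l : label => l.1 == i)) s).
have hall : all (fun l => i < l.1 < i.+1 + m)%N
    (seq.filter (predC (fun l : label => l.1 == i)) s).
  apply/allP => l; rewrite mem_filter /= => /andP[li /sP].
  by rewrite addSnnS => /andP[il ->]; rewrite ltn_neqAle eq_sym li il.
case: (seq.filter (fun l : label => l.1 == i) s) => [|l [|l' s']] //=.
  by move=> /(IH _ hall) h; rewrite add0n ltnW.
by move=> /andP[_ /(IH _ hall)].
Qed.

(** The combinatorial core of Ky Fan's lemma. Order the labels by index. To leave a sequence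
    alternating from [b], one that alternates from [b] must lose its last label, and one that
    alternates from [~~ b] its first. In any other sequence zero or two deletions succeed, since a
    repeated label, or two neighbours of equal sign, can be thinned out in two ways. *)
Lemma face_sum_alternates m i b s :
  {in s, forall l, opp_label l \notin s} ->
  all (fun l => i <= l.1 < i + m)%N s ->
  face_sum (alternates m i b) s = alternates m i b s + alternates m i (~~ b) s.
Proof.
elim: m i b s => [|m IH] i b s hs /=.
  by case: s {hs} => //= l s; rewrite addn0 ltnNge => /andP[/andP[->]].
move=> /allP sP; set p := (fun l : label => l.1 == i).
pose H (s0 s1 : seq label) := match s0 with
    | [::] => alternates m i.+1 b s1
    | [:: l] => (l.2 == b) && alternates m i.+1 (~~ b) s1
    | _ => false end.
rewrite (eq_face_sum (G' := fun l => H (seq.filter p l) (seq.filter (predC p) l))) //.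
rewrite face_sum_filter.
have hall : all (fun l => i < l.1 < i.+1 + m)%N (seq.filter (predC p) s).
  apply/allP => l; rewrite mem_filter /= => /andP[li /sP].
  by rewrite addSnnS => /andP[il ->]; rewrite ltn_neqAle eq_sym li il.
have hopp : {in seq.filter (predC p) s,
    forall l, opp_label l \notin seq.filter (predC p) s}.
  move=> l; rewrite mem_filter => /andP[_ /hs]; rewrite mem_filter.
  by move=> /negbTE ->; rewrite andbF.
have {}IH b' := IH i.+1 b' _ hopp hall.
have same : {in seq.filter p s &, forall l l' : label, l.2 = l'.2}.
  move=> [a x] [a' x']; rewrite !mem_filter /p /= => /andP[/eqP -> h].
  move=> /andP[/eqP -> h'].
  have := hs _ h; rewrite /opp_label /=.
  by case: x h; case: x' h' => // -> //.
(* Of two labels of index [i], deleting either one has the same effect; with three or more, no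
   deletion succeeds. *)
case: (seq.filter p s) same => [_|x [_|y [|z s0]]] /=.
- by rewrite add0r IH.
- rewrite addr0; case: (eqVneq x.2 b) => [->|xb] /=.
    rewrite IH negbK addrCA addbool2 addr0.
    by rewrite (_ : (b == ~~ b) = false) ?addr0//; case: (b).
  have -> : x.2 = ~~ b by case: (x.2) xb; case: (b).
  by rewrite eqxx negbK face_sum0 addr0 add0r.
- move=> same.
  have -> : x.2 = y.2 by apply: same; rewrite !inE eqxx ?orbT.
  by rewrite face_sum0 !addr0 addbool2.
- by move=> _; rewrite !(face_sum0 : forall s, face_sum xpred0 s = false).
Qed.

(** * The subdivided cube *)

Section Cells.
Context {n : nat}.

(* A cell of the cubical grid: an even entry stands for a vertex and an odd
   entry for an open interval between two vertices, so that the cells are the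
   vertices of the barycentric subdivision, and its simplices are the flags. *)
Definition cell := 'I_n -> int.
Implicit Types (x y : cell) (H : cell -> bool) (G : seq cell -> bool).

Definition upd x j a : cell := fun i => if i == j then a else x i.

Definition oddz (a : int) := odd `|a|.

Lemma oddzD1 a : oddz (a + 1) = ~~ oddz a.
Proof. rewrite /oddz; lia. Qed.

Lemma oddzB1 a : oddz (a - 1) = ~~ oddz a.
Proof. rewrite /oddz; lia. Qed.

Lemma oddzN a : oddz (- a) = oddz a.
Proof. by rewrite /oddz abszN. Qed.

Lemma updE x j a i : upd x j a i = if i == j then a else x i.
Proof. by []. Qed.

Lemma upd_upd x j a b : upd (upd x j a) j b = upd x j b.
Proof. by apply/funext => i; rewrite !updE; case: eqP. Qed.

Lemma upd_comm x i j a b : i != j -> upd (upd x i a) j b = upd (upd x j b) i a.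
Proof.
move=> ij; apply/funext => l; rewrite !updE.
by case: (eqVneq l i) => [->|//]; rewrite (negbTE ij).
Qed.

Lemma upd_id x j : upd x j (x j) = x.
Proof. by apply/funext => i; rewrite updE; case: eqP => [->|]. Qed.

(** The sum of [H] over the facets of the cell [x]: an odd entry, which is an interval, is moved to
    one of its two ends. *)
Definition bd H x : bool :=
  \sum_(j | oddz (x j)) (H (upd x j (x j - 1)) + H (upd x j (x j + 1))).

Lemma eq_bd H H' x :
  (forall j a, oddz (x j) -> a = x j - 1 \/ a = x j + 1 ->
     H (upd x j a) = H' (upd x j a)) -> bd H x = bd H' x.
Proof. by move=> e; apply: eq_bigr => j oj; congr (_ + _); apply: e; auto. Qed.

Lemma bdD H H' x : bd (fun y => H y + H' y) x = bd H x + bd H' x.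
Proof. by rewrite /bd -big_split; apply: eq_bigr => j _; rewrite addrACA. Qed.

Lemma bd_const (b : bool) x : bd (fun=> b) x = 0.
Proof. by apply: big1 => j _; rewrite addbool2. Qed.

Lemma bd_bd H x : bd (bd H) x = 0.
Proof.
(* Modulo 2, a symmetric function sums to zero over the ordered pairs of distinct indices; here the
   pairs are two directions collapsed in either order. *)
have swap (F : 'I_n -> 'I_n -> bool) (P : pred 'I_n) :
    (forall i j, F i j = F j i) ->
    \sum_(i | P i) \sum_(j | (j != i) && P j) F i j = 0.
  move=> Fsym.
  pose F' (i j : 'I_n) := if (i < j)%N then F i j else 0.
  rewrite (eq_bigr (fun i => \sum_(j | P j) F' i j + \sum_(j | P j) F' j i)).
    by rewrite big_split /= [X in _ + X]exchange_big addbool2.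
  move=> i Pi; rewrite -big_split [RHS](bigD1 i Pi) /= /F' ltnn addr0 add0r.
  apply: congr_big => // j; first by rewrite andbC.
  move=> /andP[ji _]; have := ji; rewrite -(inj_eq val_inj) /= neq_ltn.
  by case: ltngtP => // h _; rewrite (addr0, add0r) // Fsym.
pose F i j := let e a b := H (upd (upd x i (x i + a)) j (x j + b)) in
  e (-1) (-1) + e (-1) 1 + (e 1 (-1) + e 1 1).
rewrite {1}/bd -[RHS](swap F (fun j => oddz (x j))).
  apply: eq_bigr => i oi.
  have bdE a : ~~ oddz a -> bd H (upd x i a) = \sum_(j | (j != i) && oddz (x j))
      (H (upd (upd x i a) j (x j - 1)) + H (upd (upd x i a) j (x j + 1))).
    move=> ea; apply: congr_big => // j; rewrite !updE; case: eqVneq => //= _;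
    by rewrite (negbTE ea).
  by rewrite !bdE ?oddzB1 ?oddzD1 ?oi// -big_split.
move=> i j; case: (eqVneq i j) => [->//|ij].
by rewrite /F /= !(upd_comm _ _ _ ij) addrACA.
Qed.

(** The sum of [G] over the flags of [d + 1] cells that start at [x], each cell being a facet of the
    one before. *)
Fixpoint flag_sum G d x : bool :=
  if d is d'.+1 then bd (flag_sum (fun l => G (x :: l)) d') x else G [:: x].

Lemma flag_sumD G G' d x :
  flag_sum (fun l => G l + G' l) d x = flag_sum G d x + flag_sum G' d x.
Proof.
elim: d x G G' => //= d IH x G G'; rewrite -bdD.
by apply: eq_bd => j a _ _; rewrite IH.
Qed.

Lemma flag_sum0 d x : flag_sum xpred0 d x = false.
Proof.
elim: d x => //= d IH x; rewrite -[RHS](bd_const false x).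
by apply: eq_bd => j a _ _; exact: IH.
Qed.

(* Removing an inner cell of a flag leaves two ways to restore it, and removing
   its vertex leaves the two ends of an edge. *)
Lemma flag_sum_face_sum G d x :
  flag_sum (face_sum G) d.+1 x = bd (flag_sum G d) x.
Proof.
elim: d x G => [|d IH] x G.
  rewrite /= (bdD (fun y => G [:: y]) (fun=> G [:: x] + 0)) bd_const.
  by rewrite addr0.
transitivity (bd (fun y => flag_sum G d.+1 y +
    flag_sum (face_sum (fun l => G (x :: l))) d.+1 y) x).
  by apply: eq_bd => j a _ _; rewrite -flag_sumD.
rewrite bdD -[RHS]addr0; congr (_ + _).
(* Deleting the first cell gave the right-hand side; by induction, the other deletions add up to a
   double boundary. *)
rewrite -[RHS](bd_bd (flag_sum (fun l => G (x :: l)) d) x).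
by apply: eq_bd => j a _ _; rewrite IH.
Qed.

Definition face x y : bool := [forall j, (y j == x j) ||
  oddz (x j) && ((y j == x j - 1) || (y j == x j + 1))].

Lemma facexx x : face x x.
Proof. by apply/forallP => j; rewrite eqxx. Qed.

Lemma face_upd x j a :
  oddz (x j) -> a = x j - 1 \/ a = x j + 1 -> face x (upd x j a).
Proof.
move=> oj ha; apply/forallP => i; rewrite updE.
case: (eqVneq i j) => [->|_]; last by rewrite eqxx.
by rewrite oj; case: ha => ->; rewrite eqxx ?orbT.
Qed.

Lemma face_trans x y z : face x y -> face y z -> face x z.
Proof.
move=> /forallP xy /forallP yz; apply/forallP => j.
have /orP[/eqP->//|/andP[oy yzj]] := yz j.
have /orP[/eqP yx|/andP[ox]] := xy j; first by rewrite -yx oy yzj orbT.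
by case/orP => /eqP yx; rewrite yx ?oddzB1 ?oddzD1 ox in oy.
Qed.

Lemma eq_flag_sum G G' d x :
  (forall l, size l = d.+1 -> all (face x) l -> G l = G' l) ->
  flag_sum G d x = flag_sum G' d x.
Proof.
elim: d x G G' => [|d IH] x G G' e /=; first by rewrite e//= facexx.
apply: eq_bd => j a oj ha; apply: IH => l sl ll; apply: e => /=.
  by rewrite sl.
rewrite facexx; apply: sub_all ll => y; apply: face_trans.
exact: face_upd.
Qed.

Definition flip (P : pred 'I_n) x : cell := fun i => if P i then - x i else x i.

Lemma bd_flip P H x : bd H (flip P x) = bd (fun y => H (flip P y)) x.
Proof.
apply: congr_big => // j; rewrite /flip; first by case: (P j); rewrite ?oddzN.
move=> _.
have fu a : upd (flip P x) j (if P j then - a else a) = flip P (upd x j a).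
  by apply/funext => i; rewrite !updE /flip !updE; case: eqP => // ->.
rewrite -![in RHS]/(flip P _) -!fu /flip; case: (P j) => //.
by rewrite addrC !opprD opprK.
Qed.

Lemma flag_sum_flip P G d x :
  flag_sum G d (flip P x) = flag_sum (fun l => G (map (flip P) l)) d x.
Proof.
elim: d x G => //= d IH x G; rewrite bd_flip.
by apply: eq_bd => j a _ _; rewrite IH.
Qed.

(** A flag of this length must collapse the direction [e] at some stage. The two ends to choose from
    then give the same value of [G], so the flags cancel in pairs. *)
Lemma flag_sum_degenerate e G d x :
  oddz (x e) -> (#|[pred j | oddz (x j)]| <= d)%N ->
  (forall l, all (face x) l -> G l = G (map (fun y => upd y e 0) l)) ->
  flag_sum G d x = 0.
Proof.
move=> oe xd Ge.
pose G0 G l := G (map (fun y => upd y e 0) l) : bool.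
rewrite (eq_flag_sum (G' := G0 G)); last by move=> l _ /Ge.
(* Once the entry at [e] is even, its value no longer matters. *)
have flat G' d' y a : ~~ oddz (y e) -> ~~ oddz a ->
    flag_sum (G0 G') d' (upd y e a) = flag_sum (G0 G') d' y.
  elim: d' y G' => [|d' IH] y G' ey ea; first by rewrite /= /G0 /= upd_upd.
  rewrite /= /bd; apply: congr_big => // j; rewrite !updE.
    by case: eqVneq => [->|//]; rewrite (negbTE ea) (negbTE ey).
  case: (eqVneq j e) => [->|je]; first by rewrite (negbTE ea).
  move=> _; rewrite -![upd (upd y e a) j _](upd_comm _ _ _ je).
  rewrite (_ : (fun l => _) = G0 (fun l => G' (upd y e 0 :: l))); last first.
    by apply/funext => l; rewrite /G0 /= upd_upd.
  by rewrite !IH// updE eq_sym (negbTE je).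
elim: d x {Ge} G xd oe => [|d IH] x G xd oe.
  by move: xd; rewrite leqn0 => /eqP/card0_eq/(_ e); rewrite !inE oe.
rewrite /= (_ : (fun l => _) = G0 (fun l => G (upd x e 0 :: l))) //.
rewrite /bd (bigD1 e oe) /= big1 ?addr0 => [|j /andP[oj je]].
  rewrite -(flat _ _ _ (x e + 1)) ?updE ?eqxx ?upd_upd ?addbool2//.
    by rewrite oddzB1 oe.
  by rewrite oddzD1 oe.
have cardj a : ~~ oddz a -> (#|[pred i | oddz (upd x j a i)]| <= d)%N.
  move=> ea; rewrite -ltnS; apply: leq_trans xd; apply: proper_card.
  apply/properP; split; last by exists j; rewrite !inE ?updE ?eqxx.
  apply/fintype.subsetP => i; rewrite !inE updE; case: eqVneq => // _.
  by rewrite (negbTE ea).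
by rewrite !IH ?addbool2 ?cardj ?oddzB1 ?oddzD1 ?oj// updE eq_sym (negbTE je).
Qed.

End Cells.

(** * Top-dimensional cells of a subcube and a discrete Stokes formula *)

Section Boxes.
Context {n : nat} (N : nat).
Implicit Types (x y : @cell n) (H : @cell n -> bool) (l : seq 'I_n).

(** For [a < 2N] these are the odd numbers between [-2N] and [2N], that is, the intervals of the
    grid along one axis. *)
Definition odd_value (a : nat) : int := a.*2.+1%:Z - N.*2%:Z.

(** The sum of [H] over the top-dimensional cells of the subcube that extends in the directions [l],
    the other entries being those of [x]. *)
Fixpoint box_sum l H x : bool :=
  if l is j :: l' then
    \sum_(a < N.*2) box_sum l' H (upd x j (odd_value a))
  else H x.

Lemma oddz_odd_value a : oddz (odd_value a).
Proof. rewrite /oddz /odd_value; lia. Qed.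

Lemma oddz_double : oddz N.*2 = false.
Proof. rewrite /oddz; lia. Qed.

Lemma odd_value_bound (a : 'I_N.*2) : `|odd_value a| <= N.*2%:Z.
Proof. have := ltn_ord a; rewrite /odd_value; lia. Qed.

Lemma eq_box_sum l H H' x :
  (forall y, (forall i, i \notin l -> y i = x i) ->
     (forall i, i \in l -> oddz (y i) /\ `|y i| <= N.*2%:Z) -> H y = H' y) ->
  box_sum l H x = box_sum l H' x.
Proof.
elim: l x => [|j l IH] x e /=; first by apply: e.
apply: eq_bigr => a _; apply: IH => y yx yl; apply: e => i; rewrite inE.
  rewrite negb_or => /andP[ij il]; rewrite yx// updE.
  by rewrite (negbTE ij).
case: (boolP (i \in l)) => [il _|il]; first exact: yl.
rewrite orbF => /eqP ij; rewrite {i}ij in il *.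
by rewrite yx// updE eqxx oddz_odd_value odd_value_bound.
Qed.

Lemma box_sum_sum l (I : Type) (r : seq I) (P : pred I) (F : I -> @cell n -> bool) x :
  box_sum l (fun y => \sum_(i <- r | P i) F i y) x =
  \sum_(i <- r | P i) box_sum l (F i) x.
Proof.
elim: l x => //= j l IH x.
by rewrite exchange_big; apply: eq_bigr => a _; rewrite IH.
Qed.

Lemma box_sumD l H H' x :
  box_sum l (fun y => H y + H' y) x = box_sum l H x + box_sum l H' x.
Proof.
elim: l x => //= j l IH x.
by rewrite -big_split; apply: eq_bigr => a _; rewrite IH.
Qed.

Lemma box_sum0 l x : box_sum l xpred0 x = false.
Proof. by elim: l x => //= j l IH x; apply: big1. Qed.

Lemma box_sum_upd l H x j a :
  j \notin l -> box_sum l H (upd x j a) = box_sum l (fun y => H (upd y j a)) x.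
Proof.
elim: l x => //= i l IH x; rewrite inE negb_or => /andP[ji jl].
by apply: eq_bigr => b _; rewrite upd_comm// IH.
Qed.

Lemma box_sum_rem l H x j : uniq l -> j \in l ->
  box_sum l H x =
  box_sum (rem j l) (fun y => \sum_(a < N.*2) H (upd y j (odd_value a))) x.
Proof.
elim: l x => //= i l IH x /andP[il ul]; rewrite inE eq_sym.
case: (eqVneq i j) => [<- _|ij /= jl].
  by rewrite box_sum_sum; apply: eq_bigr => a _; rewrite box_sum_upd.
by apply: eq_bigr => b _; rewrite IH.
Qed.

Lemma box_sum_outside l H x x' :
  (forall i, i \notin l -> x i = x' i) -> box_sum l H x = box_sum l H x'.
Proof.
elim: l x x' => /= [|j l IH] x x' e; first by congr H; apply/funext => i; exact: e.
apply: eq_bigr => a _; apply: IH => i il; rewrite !updE.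
by case: (eqVneq i j) => // ij; apply: e; rewrite inE negb_or ij.
Qed.

Lemma box_sum_flip l P H x :
  box_sum l H (flip P x) = box_sum l (fun y => H (flip P y)) x.
Proof.
elim: l x => //= j l IH x.
have fu a : upd (flip P x) j (if P j then - a else a) = flip P (upd x j a).
  by apply/funext => i; rewrite !updE /flip !updE; case: eqP => // ->.
under [RHS]eq_bigr => a _ do rewrite -IH -fu.
(* Reversing the order of the intervals, [a] to [2N - 1 - a], changes the sign of [odd_value]. *)
case: (P j) => //; rewrite (reindex_inj rev_ord_inj); apply: eq_bigr => a _ /=.
congr (box_sum _ _ (upd _ _ _)); rewrite /odd_value.
by have := ltn_ord a; lia.
Qed.

Lemma telescope_bool (g : nat -> bool) K :
  \sum_(a < K) (g a + g a.+1) = g 0%N + g K.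
Proof.
elim: K => [|K IH]; first by rewrite big_ord0 addbool2.
by rewrite big_ord_recr /= IH addrA -(addrA (g 0%N)) addbool2 addr0.
Qed.

(** Stokes' formula modulo 2: a facet in the interior of the subcube is shared by two cells, so only
    the two sides in each direction remain. *)
Lemma box_sum_bd l H x : uniq l -> (forall i, i \notin l -> ~~ oddz (x i)) ->
  box_sum l (bd H) x = \sum_(j <- l)
    (box_sum (rem j l) H (upd x j (- N.*2%:Z)) +
     box_sum (rem j l) H (upd x j N.*2%:Z)).
Proof.
move=> ul xl.
pose h j y := H (upd y j (y j - 1)) + H (upd y j (y j + 1)).
rewrite (eq_box_sum (H' := fun y => \sum_(j <- l) h j y)); last first.
  move=> y yx yl; rewrite big_uniq//; apply: eq_bigl => j.
  have [/yl[->]//|jl] := boolP (j \in l).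
  by rewrite yx//; apply/negbTE/xl.
rewrite box_sum_sum big_seq [RHS]big_seq; apply: eq_bigr => j jl.
rewrite (box_sum_rem _ _ ul jl).
rewrite !box_sum_upd; last 2 first.
- by rewrite mem_rem_uniq// inE eqxx.
- by rewrite mem_rem_uniq// inE eqxx.
rewrite -box_sumD; apply: eq_box_sum => y _ _.
(* The ends of the interval number [a] are the vertices [2a - 2N] and [2(a + 1) - 2N], so the sum
   telescopes. *)
rewrite (eq_bigr (fun a : 'I_N.*2 => let g b := H (upd y j (b.*2%:Z - N.*2%:Z)) in
   g a + g a.+1)) => [|a _].
  rewrite (telescope_bool (fun b => H (upd y j (b.*2%:Z - N.*2%:Z)))).
  congr (H (upd _ _ _) + H (upd _ _ _)); lia.
rewrite /h !updE !eqxx !upd_upd /odd_value /=.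
by congr (H (upd _ _ _) + H (upd _ _ _)); lia.
Qed.

End Boxes.

(** * Ky Fan's parity argument on the labelled cube *)

Section CubeLabelling.
Context {n : nat} (N : nat) (lab : @cell n -> label).
Implicit Types (x y : @cell n).

Definition in_box x := forall i, `|x i| <= N.*2%:Z.

(* The union of the two faces in direction [j] of the subcube of dimension [d]
   on which the coordinates of index at least [d] are maximal. *)
Definition on_facet (d : nat) (j : 'I_n) x :=
  [/\ in_box x, forall i : 'I_n, (d <= i)%N -> x i = N.*2%:Z
    & `|x j| = N.*2%:Z].

Lemma in_box_face x y : in_box x -> face x y -> in_box y.
Proof.
move=> bx /forallP xy j; have := bx j; have /orP[/eqP ->//|/andP[ox]] := xy j.
by case/orP => /eqP ->; move: ox; rewrite /oddz; lia.
Qed.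

Lemma face_even x y j : face x y -> ~~ oddz (x j) -> y j = x j.
Proof. by move=> /forallP/(_ j)/orP[/eqP//|/andP[->]]. Qed.

Lemma on_facet_face d j x y : on_facet d j x -> face x y -> on_facet d j y.
Proof.
move=> [bx xd xj] xy; split; first exact: in_box_face xy.
  by move=> i di; rewrite (face_even xy) ?xd ?oddz_double.
by rewrite (face_even xy)//; move: xj; rewrite /oddz; lia.
Qed.

Let alt b d x := flag_sum (fun l => alternates n 0 b (map lab l)) d x.

(** Fan's count and Stokes' formula turn [A d.+1] into the number of flags on the sides of the
    subcube that alternate from [true]. The directions [j < d] contribute nothing, as their sides
    are degenerate or identified with each other. In direction [d] the labels are opposite on
    opposite sides, so the two sides together count the flags on one of them that alternate from
    either sign, which is [A d]. *)
Theorem cube_labelling :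
  (forall x, (lab x).1 < n)%N ->
  (forall x y z, in_box x -> face x y -> face x z -> lab z <> opp_label (lab y)) ->
  (forall j : 'I_n, exists P : pred 'I_n,
    [/\ P j, forall i, P i -> (i <= j)%N
      & forall x, on_facet j.+1 j x -> lab (flip P x) = opp_label (lab x)]) ->
  (forall d (j : 'I_n), (j.+1 < d <= n)%N ->
     (exists e : 'I_n, [/\ (e < d)%N, e != j
        & forall x, on_facet d j x -> lab (upd x e 0) = lab x]) \/
     (exists P : pred 'I_n, [/\ P j, forall i, P i -> (i < d)%N
        & forall x, on_facet d j x -> lab (flip P x) = lab x])) ->
  False.
Proof.
move=> labn nocomp odd_sym sym.
pose c (d : nat) := [seq j : 'I_n <- enum 'I_n | (j < d)%N].
have uc d : uniq (c d) by rewrite filter_uniq ?enum_uniq.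
have mc d j : (j \in c d) = (j < d)%N by rewrite mem_filter mem_enum andbT.
pose x0 : @cell n := fun=> N.*2%:Z.
(* The parity of the number of alternating simplices of the subcube of dimension [d], with either
   first sign. *)
pose A d := box_sum N (c d) (fun x => alt true d x + alt false d x) x0.
have box_ok d y : (forall i, i \notin c d -> y i = x0 i) ->
    (forall i, i \in c d -> oddz (y i) /\ `|y i| <= N.*2%:Z) -> in_box y.
  move=> yx yc i; have [/yc[]//|ic] := boolP (i \in c d).
  by rewrite yx// /x0; lia.
have altD d x : in_box x -> alt true d.+1 x + alt false d.+1 x = bd (alt true d) x.
  move=> bx; rewrite -flag_sumD /alt -flag_sum_face_sum; apply: eq_flag_sum.
  move=> l _ lx; rewrite face_sum_map -(@face_sum_alternates n 0 true)//.
    have allP (Q : pred (@cell n)) s : all Q s -> {in map lab s, forall u,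
        exists2 y, Q y & u = lab y}.
      elim: s => //= y s IH /andP[Qy /IH h] u; rewrite inE => /orP[/eqP ->|/h//].
      by exists y.
    move=> u /(allP _ _ lx)[y xy ->]; apply/negP => /(allP _ _ lx)[z xz].
    by move/esym/(nocomp _ _ _ bx xy xz).
  by elim: l {lx} => //= y l ->; rewrite labn.
have rem_c d (j : 'I_n) : (j < d)%N -> forall i, (i \notin rem j (c d)) = (i == j) || (d <= i)%N.
  by move=> jd i; rewrite mem_rem_uniq// inE mc negb_and negbK -leqNgt.
have facet d (j : 'I_n) (y : @cell n) : (j < d)%N ->
    (forall i, i \notin rem j (c d) -> y i = x0 i) ->
    (forall i, i \in rem j (c d) -> oddz (y i) /\ `|y i| <= N.*2%:Z) ->
    on_facet d j y.
  move=> jd yx yc; split.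
  - move=> i; have [/yc[]//|ic] := boolP (i \in rem j (c d)).
    by rewrite yx// /x0; lia.
  - by move=> i di; rewrite yx// rem_c// di orbT.
  - by rewrite yx ?rem_c ?eqxx// /x0; lia.
(* The reflection carries one side in direction [j] to the other; passing to opposite labels
   exchanges the two first signs. *)
have alt_flip b b' d d' (j : 'I_n) (P : pred 'I_n) : (j < d)%N -> P j ->
    (forall i, P i -> (i < d)%N) ->
    (forall x, on_facet d j x -> lab (flip P x) =
       if b == b' then lab x else opp_label (lab x)) ->
    box_sum N (rem j (c d)) (alt b d') (upd x0 j (- N.*2%:Z)) =
    box_sum N (rem j (c d)) (alt b' d') x0.
  move=> jd Pj Pd hP.
  rewrite (@box_sum_outside n N _ _ _ (flip P x0)); last first.
    move=> i; rewrite rem_c// updE /flip.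
    case: (eqVneq i j) => [->|_ /= di]; first by rewrite Pj.
    by case: ifP => // /Pd; rewrite ltnNge di.
  rewrite box_sum_flip; apply: eq_box_sum => y yx yc.
  rewrite /alt flag_sum_flip; apply: eq_flag_sum => l _ lx.
  have -> : map lab (map (flip P) l) = map (fun u => if b == b' then u else opp_label u) (map lab l).
    rewrite -!map_comp; elim: l lx => //= z l IH /andP[yz /IH ->].
    by rewrite hP//; apply: on_facet_face yz; exact: facet.
  case: (eqVneq b b') => [->|bb']; first by rewrite map_id.
  rewrite alternates_opp; congr alternates.
  by case: b b' bb' {hP} => -[].
have step d : (d < n)%N -> A d.+1 = A d.
  move=> dn; pose jd := Ordinal dn.
  rewrite /A (eq_box_sum (H' := bd (alt true d))); last first.
    by move=> y yx yc; rewrite altD//; exact: box_ok yx yc.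
  rewrite box_sum_bd//; last by move=> i _; rewrite /x0 oddz_double.
  rewrite (bigD1_seq jd)//=; last by rewrite mc /=.
  have upd0 j : upd x0 j N.*2%:Z = x0 by rewrite -[X in upd _ _ X]/(x0 j) upd_id.
  rewrite big1_seq ?addr0; last first.
    move=> j /andP[jjd]; rewrite mc ltnS leq_eqVlt => /orP[/eqP jd'|ltjd].
      by case/eqP: jjd; apply: val_inj.
    rewrite upd0.
    have jd1 : (j < d.+1)%N by rewrite ltnW.
    have [|[e [ed ej he]]|[P [Pj Pd hP]]] := sym d.+1 j; first by rewrite ltnS ltjd.
      (* The cells of these sides extend in the direction [e], which the labels ignore. *)
      have zero y : on_facet d.+1 j y ->
          (forall i, i \in rem j (c d.+1) -> oddz (y i)) ->
          alt true d y = 0.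
        move=> fy yc; apply: (@flag_sum_degenerate _ e).
        - by apply: yc; rewrite mem_rem_uniq// inE ej mc.
        - rewrite -[leqRHS](_ : size (rem j (c d.+1)) = _); last first.
            rewrite size_rem ?mc// size_filter.
            rewrite (eq_count (a2 := preim val (fun i => i < 0 + d.+1)%N))//.
            rewrite -(count_map val) val_enum_ord.
            rewrite -size_filter filter_iota_ltn ?size_iota ?subn0//.
          rewrite cardE; apply: uniq_leq_size; first exact: enum_uniq.
          move=> i; rewrite mem_enum inE; apply: contraTT.
          rewrite rem_c// => /orP[/eqP ->|di]; case: fy => _ yd yj.
            by move: yj; rewrite /oddz; lia.
          by rewrite yd// oddz_double.
        - move=> l lx; congr alternates; rewrite -map_comp.
          elim: l lx => //= z l IH /andP[yz /IH ->].
          by rewrite he//; apply: on_facet_face yz.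
      rewrite (eq_box_sum (x := x0) (H' := xpred0)); last first.
        by move=> y yx yc; apply: zero; [exact: facet | by move=> i /yc[]].
      rewrite (eq_box_sum (x := upd _ _ _) (H' := xpred0)) ?box_sum0//.
      move=> y yx yc; apply: zero; last by move=> i /yc[].
      split.
      - move=> i; have [/yc[]//|ic] := boolP (i \in rem j (c d.+1)).
        by rewrite yx// updE /x0; case: eqP => _; lia.
      - move=> i di; rewrite yx ?rem_c ?di ?orbT// updE.
        by case: eqVneq => // ij; move: di; rewrite ij leqNgt jd1.
      - by rewrite yx ?rem_c ?eqxx// updE eqxx; lia.
    by rewrite (alt_flip true true d.+1 d j P)// addbool2.
  have [P [Pj Pd hP]] := odd_sym jd.
  rewrite upd0 (alt_flip true false d.+1 d jd P)// -box_sumD.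
  have -> : rem jd (c d.+1) = c d.
    rewrite rem_filter// -filter_predI; apply: eq_filter => i /=.
    rewrite ltnS leq_eqVlt -(inj_eq val_inj) /=.
    by case: ltngtP.
  by apply: eq_box_sum => y _ _; rewrite addrC.
have A0 : A 0%N = true.
  rewrite /A (_ : c 0%N = [::]) /=; last by apply/eqP; rewrite -size_eq0 size_filter (eq_count (a2 := pred0)) ?count_pred0.
  (* A single label alternates from exactly one sign: deleting it leaves the empty sequence, which
     counts once. *)
  rewrite /alt /= -(@face_sum_alternates n 0 true [:: lab x0]) /= ?labn//.
    by rewrite addr0; elim: (n) (0%N) => //= m IH i; rewrite IH.
  by move=> u; rewrite !inE => /eqP ->; case: (lab x0) => a []; rewrite xpair_eqE andbF.
have An : A n = false.
  rewrite /A (eq_box_sum (H' := fun=> false)); last first.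
    move=> y _ _.
    suff h b : alt b n y = false by rewrite !h.
    rewrite /alt (eq_flag_sum (G' := fun=> false)); last first.
      move=> l sl _; apply/negP => /alternates_size.
      rewrite size_map sl ltnn => h; suff : false by [].
      by apply: h; elim: l {sl} => //= z l ->; rewrite labn.
    exact: flag_sum0.
  exact: box_sum0.
suff : A n = A 0%N by rewrite A0 An.
have : (n <= n)%N by [].
elim: {-2}(n) => // d IH dn.
by rewrite step// IH// ltnW.
Qed.

End CubeLabelling.

(** * Zeros of continuous maps on the cube *)

Section CubeZero.
Context {R : realType} {n : nat}.
Implicit Types (s t : 'rV[R]_n) (P : pred 'I_n).

Definition cube : set 'rV[R]_n := [set s | forall i, s 0 i \in `[-1, 1]].

Lemma compact_cube : compact cube.
Proof. exact: (@rV_compact R n (fun=> `[-1, 1]%classic) (fun=> @segment_compact R _ _)). Qed.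

Definition facet (d : nat) (j : 'I_n) : set 'rV[R]_n :=
  [set s | [/\ cube s, forall i : 'I_n, (d <= i)%N -> s 0 i = 1
    & `|s 0 j| = 1]].

Definition negate P s : 'rV[R]_n := \row_i (if P i then - s 0 i else s 0 i).

Definition erase e s : 'rV[R]_n := \row_i (if i == e then 0 else s 0 i).

Definition largest (i0 : 'I_n) (f : 'I_n -> R) : 'I_n :=
  [arg max_(i > i0) `|f i|]%O.

Definition sign_label (i0 : 'I_n) (f : 'I_n -> R) : label :=
  (val (largest i0 f), f (largest i0 f) < 0).

Lemma sign_label_opp i0 (f : 'I_n -> R) :
  (exists i, f i != 0) -> sign_label i0 (fun i => - f i) = opp_label (sign_label i0 f).
Proof.
move=> [i fi]; rewrite /sign_label /opp_label /=.
have -> : largest i0 (fun i => - f i) = largest i0 f.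
  rewrite /largest (_ : (fun i => `|- f i|) = (fun i => `|f i|))//.
  by apply/funext => j; rewrite normrN.
congr pair; rewrite oppr_lt0 -leNgt lt_neqAle eq_sym andb_idl// => _.
rewrite /largest; case: arg_maxP => //= j _ /(_ i isT) h.
by rewrite -normr_gt0 (lt_le_trans _ h)// normr_gt0.
Qed.

(** The largest components of [f] and [g] exceed [2 * e] in absolute value. If they had the same
    index and opposite signs they would differ by more than [4 * e], whereas both are within [e] of
    [h]. *)
Lemma sign_label_close i0 (f g : 'I_n -> R) (h : 'I_n -> R) (e : R) :
  (exists i, 3 * e <= `|h i|) -> 0 < e ->
  (forall i, `|h i - f i| < e) -> (forall i, `|h i - g i| < e) ->
  sign_label i0 g <> opp_label (sign_label i0 f).
Proof.
move=> [i hi] e0 hf hg [/val_inj].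
have lf : 2 * e < `|f (largest i0 f)|.
  rewrite /largest; case: arg_maxP => //= j _ /(_ i isT); apply: lt_le_trans.
  by have := ler_normD (h i - f i) (f i); rewrite subrK; move: (hf i) hi; lra.
have lg : 2 * e < `|g (largest i0 g)|.
  rewrite /largest; case: arg_maxP => //= j _ /(_ i isT); apply: lt_le_trans.
  by have := ler_normD (h i - g i) (g i); rewrite subrK; move: (hg i) hi; lra.
move=> eq; rewrite eq in lg *; move: (largest i0 f) lf lg => j lf lg.
have := hf j; have := hg j; rewrite !ltr_norml => hgj hfj.
case: (ltrP (g j) 0) => gj; case: (ltrP (f j) 0) => fj //= _.
- by move: lf lg; rewrite (ltr0_norm gj) (ger0_norm fj); lra.
- by move: lf lg; rewrite (ltr0_norm fj) (ger0_norm gj); lra.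
Qed.

(** Without a zero, compactness yields a mesh below which no two nearby points have opposite labels,
    and the grid of that mesh contradicts [cube_labelling]. *)
Theorem cube_zero (F : 'rV[R]_n -> 'I_n -> R) :
  (0 < n)%N ->
  (forall i, continuous (fun s => F s i)) ->
  (forall j : 'I_n, exists P : pred 'I_n,
    [/\ P j, forall i, P i -> (i <= j)%N
      & forall s, facet j.+1 j s -> forall i, F (negate P s) i = - F s i]) ->
  (forall d (j : 'I_n), (j.+1 < d <= n)%N ->
     (exists e : 'I_n, [/\ (e < d)%N, e != j
        & forall s, facet d j s -> F (erase e s) = F s]) \/
     (exists P : pred 'I_n, [/\ P j, forall i, P i -> (i < d)%N
        & forall s, facet d j s -> F (negate P s) = F s])) ->
  exists2 s, cube s & forall i, F s i = 0.
Proof.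
move=> n0 Fc odd_sym sym; apply: contrapT => noz.
have {noz}F0 s : cube s -> exists i, F s i != 0.
  move=> cs; apply: contrapT => /forallNP h; apply: noz; exists s => // i.
  by apply/eqP; apply: contrapT => /negP; exact: h.
pose i0 := Ordinal n0.
pose lab s := sign_label i0 (F s).
have [K hK] : exists K : nat, forall s t, cube s -> cube t ->
    (forall i, `|s 0 i - t 0 i| <= K.+1%:R^-1) -> lab t <> opp_label (lab s).
  have /compact_near_coveringP/near_covering_withinP := compact_cube.
  move=> /(_ nat \oo (fun K s => forall t, cube t ->
    (forall i, `|s 0 i - t 0 i| <= K.+1%:R^-1) -> lab t <> opp_label (lab s))).
  case => [s cs|K _ hK]; last first.
    by exists K => s t cs ct; apply: (hK K) => //=.
  have [i Fi] := F0 _ cs.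
  pose e := `|F s i| / 3.
  have e0 : 0 < e by rewrite divr_gt0// normr_gt0.
  have : \forall t \near s, forall i, `|F s i - F t i| < e.
    by apply: (@filter_forall _ _ (fun j t => `|F s j - F t j| < e) (nbhs s)) => j; have := Fc j s => /cvgrPdist_lt/(_ _ e0).
  move=> /nbhs_ballP[d /= d0 hd].
  (* One half of the radius is for the distance from [s] to [x], the other for that from [x] to
     [t]. *)
  have d20 : 0 < d / 2 by rewrite divr_gt0.
  exists (ball s (d / 2), [set K : nat | K.+1%:R^-1 < d / 2]).
    by split; [exact: nbhsx_ballx | exact: near_infty_natSinv_lt (PosNum d20)].
  move=> [x K] /= [[_ sx] Kd] cx t ct xt.
  apply: (@sign_label_close _ _ _ (F s) e) => //.
  - by exists i; rewrite /e; lra.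
  - apply: hd; split=> // a j; rewrite ord1; apply: lt_trans (sx 0 j) _; lra.
  - apply: hd; split=> // a j; rewrite ord1 /ball /=.
    have := sx 0 j; rewrite /ball /= => h1; have := xt j => h2.
    apply: le_lt_trans (ler_distD (x 0 j) _ _) _.
    by rewrite (splitr d) ltrD// (le_lt_trans h2 Kd).
pose N := K.+1.
have N0 : 0 < N.*2%:R :> R by rewrite ltr0n double_gt0.
pose pt (x : @cell n) : 'rV[R]_n := \row_i ((x i)%:~R / N.*2%:R).
have ptE x i : pt x 0 i = (x i)%:~R / N.*2%:R by rewrite mxE.
have pt_box x i : (`|x i| <= N.*2%:Z) -> pt x 0 i \in `[-1, 1].
  move=> xi; rewrite ptE in_itv /= -ler_norml normrM normfV (gtr0_norm N0).
  by rewrite ler_pdivrMr// mul1r -intr_norm -[leRHS]/((N.*2%:Z)%:~R) ler_int.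
have pt_cube x : in_box N x -> cube (pt x) by move=> bx i; exact: pt_box.
have pt_negate P x : pt (flip P x) = negate P (pt x).
  by apply/rowP => i; rewrite !mxE /flip; case: ifP; rewrite // rmorphN mulNr.
have pt_erase e x : pt (upd x e 0) = erase e (pt x).
  by apply/rowP => i; rewrite !mxE updE; case: ifP; rewrite // mul0r.
have pt_facet d j x : on_facet N d j x -> facet d j (pt x).
  move=> [bx xd xj]; split; first exact: pt_cube.
    by move=> i di; rewrite ptE xd// -pmulrn divff// gt_eqF.
  rewrite ptE normrM normfV (gtr0_norm N0) -intr_norm xj -pmulrn divff//.
  by rewrite gt_eqF.
apply: (@cube_labelling n N (lab \o pt)) => /=.
- by move=> x; rewrite /lab /sign_label /=.
- move=> x y z bx xy xz; apply: hK; try exact/pt_cube/(in_box_face bx).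
  (* Faces of one cell differ by at most 2 in each entry, so the points differ by at most
     [2 / 2N = 1 / K.+1]. *)
  move=> i; rewrite !ptE -mulrBl -rmorphB normrM normfV (gtr0_norm N0) -intr_norm.
  rewrite ler_pdivrMr// -muln2 natrM mulrA mulVf ?mul1r; last first.
    by rewrite pnatr_eq0.
  rewrite -[leRHS]/((2%:Z)%:~R) ler_int.
  move: xy xz => /forallP/(_ i) + /forallP/(_ i).
  lia.
- move=> j; have [P [Pj Pi hP]] := odd_sym j; exists P; split=> // x fx.
  have fs := pt_facet _ _ _ fx.
  rewrite pt_negate /lab (_ : F (negate P (pt x)) = fun i => - F (pt x) i).
    by apply: sign_label_opp; apply: F0; case: fs.
  by apply/funext => i; rewrite hP.
- move=> d j jd; have [[e [ed ej he]]|[P [Pj Pi hP]]] := sym d j jd; [left|right].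
    exists e; split=> // x fx; rewrite pt_erase /lab he//.
    exact: pt_facet.
  exists P; split=> // x fx; rewrite pt_negate /lab hP//.
  exact: pt_facet.
Qed.
End CubeZero.

(** * Sublinear functions and smooth norms *)

Lemma inf_lb {R : realType} (A : set R) (b x : R) :
  (forall y, A y -> b <= y) -> A x -> inf A <= x.
Proof. by move=> Ab Ax; apply: ge_inf => //; exists b => y; exact: Ab. Qed.

Section Sublinear.
Context {R : realType} {E : lmodType R}.
Implicit Types (p q : E -> R) (x y v : E).

Definition sublinear p :=
  (forall x y, p (x + y) <= p x + p y) /\
  (forall c x, 0 < c -> p (c *: x) = c * p x).

Lemma sublinear0 p : sublinear p -> p 0 = 0.
Proof. by move=> [_ /(_ 2 0)]; rewrite scaler0 => /(_ ltac:(lra)); lra. Qed.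

Lemma sublinear_ge0 p c x : sublinear p -> 0 <= c -> p (c *: x) = c * p x.
Proof.
move=> sp; rewrite le_eqVlt => /orP[/eqP <-|]; last exact: sp.2.
by rewrite scale0r mul0r sublinear0.
Qed.

Lemma sublinearN p x : sublinear p -> - p x <= p (- x).
Proof. by move=> sp; have := sp.1 x (- x); rewrite subrr sublinear0//; lra. Qed.

(* The directional derivative of [p] at [v], when [p] is a norm. *)
Definition deriv_at p v x := inf [set p (x + t *: v) - t * p v | t in `[0, +oo[].

Lemma deriv_at_le p v x t : sublinear p -> 0 <= t ->
  deriv_at p v x <= p (x + t *: v) - t * p v.
Proof.
move=> sp t0; apply: (@inf_lb _ _ (- p (- x))); last first.
  by exists t => //=; rewrite in_itv /= andbT.
move=> y [r /=]; rewrite in_itv /= andbT => r0 <-.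
have := sp.1 (x + r *: v) (- x).
by rewrite addrAC subrr add0r (sublinear_ge0 _ sp r0); lra.
Qed.

Lemma deriv_at_ge p v x b : (forall t, 0 <= t -> b <= p (x + t *: v) - t * p v) ->
  b <= deriv_at p v x.
Proof.
move=> h; apply: lb_le_inf.
  by exists (p (x + 0 *: v) - 0 * p v); exists 0 => //=; rewrite in_itv /= lexx.
by move=> y [t /=]; rewrite in_itv /= andbT => t0 <-; exact: h.
Qed.

Lemma deriv_at_lt p v x b : sublinear p -> deriv_at p v x < b ->
  exists2 t, 0 <= t & p (x + t *: v) - t * p v < b.
Proof.
move=> sp xb; apply: contrapT => h; move: xb; rewrite ltNge => /negP; apply.
apply: deriv_at_ge => t t0; rewrite leNgt; apply/negP => tb; apply: h.
by exists t.
Qed.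

Lemma deriv_at_le_id p v x : sublinear p -> deriv_at p v x <= p x.
Proof.
by move=> sp; have := deriv_at_le v x sp (lexx 0); rewrite scale0r addr0 mul0r subr0.
Qed.

Lemma deriv_at_opp p v : sublinear p -> deriv_at p v (- v) <= - p v.
Proof.
move=> sp; have := deriv_at_le v (- v) sp ler01.
by rewrite scale1r mul1r addNr sublinear0// sub0r.
Qed.

(** If [t] and [r] almost attain the infima at [x] and [y], then [t + r] serves for [x + y]. *)
Lemma deriv_at_sublinear p v : sublinear p -> sublinear (deriv_at p v).
Proof.
move=> sp; split=> [x y|].
  apply/ler_addgt0Pr => e e0.
  have [|t t0 ht] := @deriv_at_lt p v x (deriv_at p v x + e / 2) sp; first lra.
  have [|r r0 hr] := @deriv_at_lt p v y (deriv_at p v y + e / 2) sp; first lra.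
  apply: le_trans (deriv_at_le v (x + y) sp (addr_ge0 t0 r0)) _.
  have := sp.1 (x + t *: v) (y + r *: v).
  by rewrite addrACA -scalerDl; lra.
have le_c c x : 0 < c -> deriv_at p v (c *: x) <= c * deriv_at p v x.
  move=> c0; rewrite -ler_pdivrMl//; apply: deriv_at_ge => t t0.
  rewrite ler_pdivrMl// mulrBr -(sp.2 c (x + t *: v) c0) scalerDr scalerA mulrA.
  by apply: deriv_at_le; rewrite // mulr_ge0// ltW.
move=> c x c0; apply/eqP; rewrite eq_le le_c//=.
have ci : 0 < c^-1 by rewrite invr_gt0.
have := le_c _ (c *: x) ci; rewrite scalerA mulVf ?gt_eqF// scale1r.
by rewrite ler_pdivlMl.
Qed.

(* Replacing [p] by its derivatives along the vectors of [s], one after the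
   other, makes it linear along each of them. *)
Lemma sublinear_refine p (s : seq E) : sublinear p -> exists q,
  [/\ sublinear q, forall x, q x <= p x & forall v, v \in s -> q (- v) <= - q v].
Proof.
elim: s p => [|v s IH] p sp; first by exists p; split.
have [q [sq qd qs]] := IH _ (deriv_at_sublinear v sp).
exists q; split=> // [x|w]; first exact: le_trans (qd x) (deriv_at_le_id _ _ sp).
rewrite inE => /orP[/eqP ->|/qs//].
apply: le_trans (le_trans (qd _) (deriv_at_opp v sp)) _; rewrite lerN2.
exact: le_trans (qd _) (deriv_at_le_id _ _ sp).
Qed.

End Sublinear.

Definition row_form {R : realType} {n : nat} (a : 'I_n -> R) (x : 'rV[R]_n) : R :=
  \sum_i x 0 i * a i.

Lemma row_form_linear {R : realType} {n : nat} (a : 'I_n -> R) :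
  linear_for *%R (row_form a).
Proof.
move=> c x y; rewrite /row_form mulr_sumr -big_split; apply: eq_bigr => i _.
by rewrite !mxE mulrDl mulrA.
Qed.

HB.instance Definition _ (R : realType) (n : nat) (a : 'I_n -> R) :=
  GRing.isLinear.Build R 'rV[R]_n R *%R (row_form a) (row_form_linear a).

(** Differentiating first along [y] forces every minorant obtained afterwards to agree with [p] at
    [y]; differentiating along the basis vectors then makes it linear. *)
Lemma hahn_banach_row {R : realType} {n : nat} (p : 'rV[R]_n -> R) (y : 'rV[R]_n) :
  sublinear p ->
  exists f : {scalar 'rV[R]_n}, (forall x, f x <= p x) /\ f y = p y.
Proof.
move=> sp; pose e i : 'rV[R]_n := delta_mx 0 i.
have [q [sq qd qe]] :=
  sublinear_refine [seq e i | i : 'I_n] (deriv_at_sublinear y sp).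
have qp x : q x <= p x := le_trans (qd x) (deriv_at_le_id y x sp).
pose f : {scalar 'rV[R]_n} := row_form (fun i => q (e i)).
have qf x : q x <= f x.
  have qsum (r : seq 'I_n) (g : 'I_n -> 'rV[R]_n) :
      q (\sum_(i <- r) g i) <= \sum_(i <- r) q (g i).
    elim: r => [|i r IH]; first by rewrite !big_nil sublinear0.
    by rewrite !big_cons; apply: le_trans (sq.1 _ _) _; rewrite lerD2l.
  rewrite {1}(row_sum_delta x); apply: le_trans (qsum _ _) _.
  apply: ler_sum => i _; case: (lerP 0 (x 0 i)) => xi.
    by rewrite sublinear_ge0.
  have xi' : 0 <= - x 0 i by rewrite oppr_ge0 ltW.
  have := sublinear_ge0 (- e i) sq xi'; rewrite scalerN scaleNr opprK => ->.
  rewrite -[leRHS]mulrNN ler_wpM2l//; apply: qe.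
  by apply: map_f; rewrite mem_enum.
(* A linear form above a sublinear function equals it: compare the two at [- x]. *)
have fq x : f x = q x.
  apply/eqP; rewrite eq_le qf andbT.
  have := qf (- x); rewrite linearN /=; have := sublinearN x sq; lra.
exists f; split=> [x|]; first by rewrite fq.
rewrite fq; apply/eqP; rewrite eq_le qp /=.
have := le_trans (qd (- y)) (deriv_at_opp y sp).
have := sublinearN y sq; lra.
Qed.

(** * Norms with a smooth unit ball and their derivatives *)

Section FibreNorm.
Context {R : realType} {n : nat}.
Implicit Types (L : {vspace 'rV[R]_n}) (N : 'rV[R]_n -> R) (x y u v : 'rV[R]_n).

Lemma mulmx_tr_eq0 x : x *m x^T = 0 -> x = 0.
Proof.
move=> /matrixP/(_ 0 0); rewrite !mxE => /eqP.
rewrite psumr_eq0 => [/allP sq0|j _]; last by rewrite mxE -expr2 sqr_ge0.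
apply/rowP => j; rewrite mxE; apply/eqP.
by have := sq0 j (mem_index_enum _); rewrite /= mxE -expr2 sqrf_eq0.
Qed.

Lemma orth_proj_uniq L x y : y \in L ->
  (forall z, z \in L -> (x - y) *m z^T = 0) -> x *m orth_proj L = y.
Proof.
move=> yL xy; have [PL Pperp] := orth_projP L x.
apply/eqP; rewrite -subr_eq0; apply/eqP/mulmx_tr_eq0.
have dL : x *m orth_proj L - y \in L by rewrite memvB.
have {1}-> : x *m orth_proj L - y = (x - y) - (x - x *m orth_proj L).
  by rewrite opprB [RHS]addrC subrKA.
by rewrite mulmxBl (xy _ dL) (Pperp _ dL) subrr.
Qed.

Lemma orth_proj_id L x : x \in L -> x *m orth_proj L = x.
Proof. by move=> xL; apply: orth_proj_uniq => // z _; rewrite subrr mul0mx. Qed.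

Lemma closure_ray (A : set 'rV[R]_n) x v :
  (forall t : R, 0 < t -> A (x + t *: v)) -> closure A x.
Proof.
move=> h U xU.
have cx : (fun t : R => x + t *: v) @ 0^'+ --> x.
  have {2}-> : x = x + (0 : R) *: v by rewrite scale0r addr0.
  apply: cvg_at_right_filter; apply: cvgD; first exact: cvg_cst.
  by apply: cvgZ; [exact: cvg_id | exact: cvg_cst].
have Ux : \forall t \near 0^'+, U (x + t *: v) := cx U xU.
have [t [tU t0]] := filter_ex (filterI Ux (nbhs_right_gt (0 : R))).
by exists (x + t *: v); split=> //; exact: h.
Qed.

Lemma near_subr y (P : set 'rV[R]_n) : nbhs (0 : 'rV[R]_n) P -> \forall z \near y, P (z - y).
Proof.
have : z - y @[z --> y] --> y - y.
  exact: (@cvgB R 'rV[R]_n 'rV[R]_n (nbhs y) _ id (fun=> y) y y cvg_id (cvg_cst _)).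
by rewrite subrr => c /c.
Qed.

Lemma norm_gt0 L N u : norm_on L N -> u \in L -> u != 0 -> 0 < N u.
Proof.
move=> [N0 Neq0 _ _] uL u0; rewrite lt_def N0// andbT.
by apply: contra u0 => /eqP/(Neq0 _ uL) ->.
Qed.

Lemma norm_scale L N u t : norm_on L N -> u \in L -> 0 <= t -> N (t *: u) = t * N u.
Proof. by move=> [_ _ NZ _] uL t0; rewrite NZ// ger0_norm. Qed.

Lemma norm_opp L N u : norm_on L N -> u \in L -> N (- u) = N u.
Proof. by move=> [_ _ NZ _] uL; rewrite -scaleN1r NZ// normrN1 mul1r. Qed.

Lemma norm_proj_sublinear L N :
  norm_on L N -> sublinear (fun x => N (x *m orth_proj L)).
Proof.
move=> nN; have PL x := (orth_projP L x).1; split=> [x y|c x c0].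
  by rewrite mulmxDl; case: nN => _ _ _; apply.
by rewrite -scalemxAl (norm_scale nN) ?ltW.
Qed.

(** The linear forms below the directional derivative of the norm at [u] all support the unit ball
    at [u / N u], hence agree on [L] by smoothness. By Hahn-Banach the derivative is attained by
    such forms at every point, so it is itself linear on [L]. The last two clauses say that [f y] is
    the infimum of [N (t *: u + y) - t * N u] over [t >= 0]. *)
Lemma smooth_norm_deriv L N u :
  norm_on L N -> smooth_body L (unit_ball L N) -> u \in L -> u != 0 ->
  exists f : {scalar 'rV[R]_n}, [/\ f u = N u,
    forall y t, y \in L -> 0 <= t -> f y <= N (t *: u + y) - t * N u
  & forall y b, y \in L -> f y < b ->
      exists2 t, 0 <= t & N (t *: u + y) - t * N u < b].
Proof.
move=> nN smN uL u0.
have Nu := norm_gt0 nN uL u0.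
(* Composing with the orthogonal projection extends the norm of [L] to a sublinear function on the
   whole space. *)
pose p x := N (x *m orth_proj L); have sp : sublinear p := norm_proj_sublinear nN.
have pE x : x \in L -> p x = N x by move=> xL; rewrite /p orth_proj_id.
pose q := deriv_at p u; have sq : sublinear q := deriv_at_sublinear u sp.
pose w := (N u)^-1 *: u.
have wL : w \in L by rewrite memvZ.
have Nw : N w = 1 by rewrite (norm_scale nN) ?invr_ge0 ?ltW// mulVf ?gt_eqF.
have bw : boundary L (unit_ball L N) w.
  split; first by apply: subset_closure; split; rewrite ?Nw.
  apply: (@closure_ray _ _ w) => t t0.
  rewrite -{1}(scale1r w) -scalerDl; split; first by rewrite /= memvZ.
  move=> [_]; rewrite (norm_scale nN wL) ?Nw ?mulr1; lra.
have fu (f : {scalar 'rV[R]_n}) : (forall x, f x <= q x) -> f u = N u.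
  move=> fq; apply/eqP; rewrite eq_le -{1}(pE _ uL).
  rewrite (le_trans (fq u) (deriv_at_le_id u u sp)) /=.
  have := le_trans (fq (- u)) (deriv_at_opp u sp).
  by rewrite linearN /= pE// lerN2.
have fw (f : {scalar 'rV[R]_n}) : (forall x, f x <= q x) -> f w = 1.
  by move=> fq; rewrite linearZ /= fu// mulVf ?gt_eqF.
have supp (f : {scalar 'rV[R]_n}) : (forall x, f x <= q x) ->
    supporting L (unit_ball L N) f 1 /\ hyperplane L f 1 w.
  move=> fq; split; last by split=> //; exact: fw.
  split.
  - by exists u => //; rewrite fu// gt_eqF.
  - move=> x [xL Nx]; apply: le_trans Nx; rewrite -(pE _ xL).
    exact: le_trans (fq x) (deriv_at_le_id u x sp).
  - by exists w; [split; rewrite ?Nw | exact: fw].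
have uniq (f g : {scalar 'rV[R]_n}) : (forall x, f x <= q x) ->
    (forall x, g x <= q x) -> forall x, x \in L -> f x = g x.
  move=> fq gq x xL; have [sf hf] := supp f fq; have [sg hg] := supp g gq.
  have e := smN w bw f g 1 1 sf hf sg hg.
  (* Any [x] in [L] is moved along [w] into the common hyperplane, where both forms are 1. *)
  have : hyperplane L f 1 (x + (1 - f x) *: w).
    split; first by rewrite memvD// memvZ.
    by rewrite linearD linearZ /= fw// mulr1; lra.
  by rewrite e => -[_]; rewrite linearD linearZ /= fw// mulr1; lra.
have [f [fq _]] := hahn_banach_row 0 sq.
have fE y : y \in L -> f y = q y.
  by move=> yL; have [g [gq gy]] := hahn_banach_row y sq; rewrite (uniq f g).
exists f; split; first exact: fu.
- move=> y t yL t0; rewrite fE// -(pE u)//.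
  rewrite -(pE (t *: u + y)) ?memvD ?memvZ// [t *: u + y]addrC.
  exact: deriv_at_le.
- move=> y b yL; rewrite fE// => /(deriv_at_lt sp)[t t0].
  by rewrite [y + _]addrC !pE ?memvD ?memvZ// => h; exists t.
Qed.

(** By the triangle inequality the expression does not increase with [t], so a bound reached at [t0]
    persists. A neighbourhood of each [y] costs another [e / 2], and compactness makes the threshold
    uniform. *)
Lemma smooth_norm_deriv_uniform L N u (f : {scalar 'rV[R]_n}) (A : set 'rV[R]_n) M e :
  norm_on L N -> u \in L ->
  (forall d, 0 < d -> \forall v \near (0 : 'rV[R]_n), v \in L -> N v < d) ->
  (forall y t, y \in L -> 0 <= t -> f y <= N (t *: u + y) - t * N u) ->
  (forall y b, y \in L -> f y < b ->
      exists2 t, 0 <= t & N (t *: u + y) - t * N u < b) ->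
  compact A -> A `<=` [set` L] -> (forall y, A y -> f y <= M) -> 0 < e ->
  \forall t \near +oo, forall y, A y -> N (t *: u + y) - t * N u < M + e.
Proof.
move=> nN uL Nc fle flt cA AL AM e0.
have tri := nN : norm_on L N; case: tri => _ _ _ tri.
move/compact_near_coveringP/near_covering_withinP : cA.
move=> /(_ R (pinfty_nbhs R)
  (fun t y => N (t *: u + y) - t * N u < M + e)); apply => y Ay.
have yL := AL _ Ay.
have [|t0 t00 ht] := flt y (M + e / 2) yL.
  by apply: le_lt_trans (AM _ Ay) _; rewrite ltrDl divr_gt0.
have e20 : 0 < e / 2 by rewrite divr_gt0.
have near_y : \forall z \near y, z \in L -> N (z - y) < e / 2.
  apply: filterS (near_subr y (Nc _ e20)) => z /= h zL.
  by apply: h; rewrite memvB.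
exists ([set z | z \in L -> N (z - y) < e / 2], [set t | t0 <= t]).
  by split=> //=; apply: nbhs_pinfty_ge; exact: num_real.
move=> [z t] /= [hz tt] Az; have zL := AL _ Az.
have /= hzy := hz zL.
have -> : t *: u + z = (t - t0) *: u + (t0 *: u + y) + (z - y).
  by rewrite [X in _ = X + _]addrA -scalerDl subrK -addrA [y + _]addrC subrK.
have tu : N ((t - t0) *: u) = (t - t0) * N u by rewrite (norm_scale nN)// subr_ge0.
have zyL : z - y \in L by rewrite memvB.
have uyL : t0 *: u + y \in L by rewrite memvD ?memvZ.
have tuL : (t - t0) *: u \in L by rewrite memvZ.
have := tri _ _ (memvD tuL uyL) zyL; have := tri _ _ tuL uyL; rewrite tu.
lra.
Qed.

End FibreNorm.

(** * A family of subspaces parametrized by the cube *)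

Section RealContinuity.
Context {R : realType} {T : topologicalType}.
Implicit Types f g : T -> R.

Lemma continuous_mul f g :
  continuous f -> continuous g -> continuous (fun t => f t * g t).
Proof. by move=> cf cg t; apply: cvgM; [exact: cf | exact: cg]. Qed.

Lemma continuous_add f g :
  continuous f -> continuous g -> continuous (fun t => f t + g t).
Proof. by move=> cf cg t; apply: cvgD; [exact: cf | exact: cg]. Qed.

Lemma continuous_sub f g :
  continuous f -> continuous g -> continuous (fun t => f t - g t).
Proof. by move=> cf cg t; apply: cvgB; [exact: cf | exact: cg]. Qed.

Lemma continuous_inv f :
  (forall t, f t != 0) -> continuous f -> continuous (fun t => (f t)^-1).
Proof. by move=> f0 cf t; apply: cvgV; [exact: f0 | exact: cf]. Qed.

Lemma continuous_sum (I : Type) (r : seq I) (f : I -> T -> R) :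
  (forall i, continuous (f i)) -> continuous (fun t => \sum_(i <- r) f i t).
Proof.
move=> cf; elim: r => [|i r IH].
  by under eq_fun do rewrite big_nil; exact: cst_continuous.
by under eq_fun do rewrite big_cons; apply: continuous_add.
Qed.

Lemma continuous_scale (n : nat) f (g : T -> 'rV[R]_n) :
  continuous f -> continuous g -> continuous (fun t => f t *: g t).
Proof. by move=> cf cg t; apply: cvgZ; [exact: cf | exact: cg]. Qed.

Lemma continuous_opp (n : nat) (g : T -> 'rV[R]_n) :
  continuous g -> continuous (fun t => - g t).
Proof. by move=> cg t; apply: cvgN; exact: cg. Qed.

Lemma continuous_pos_part f : continuous f -> continuous (fun t => Num.max 0 (f t)).
Proof.
by move=> cf t; apply: continuous_max; [exact: cst_continuous | exact: cf].
Qed.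

Lemma continuous_norm f : continuous f -> continuous (fun t => `|f t|).
Proof. by move=> cf t; apply: cvg_norm; exact: cf. Qed.

End RealContinuity.

(** * Rational polar coordinates *)

Section Polar.
Context {R : realType}.
Implicit Types S : nat -> R.

(* A rational substitute for spherical coordinates: as [S] ranges over
   [-1, 1]^d, the directions of [polar S d] cover half a sphere. *)
Definition polar S (d i : nat) : R :=
  if (i <= d)%N then
    (\prod_(l < i) (1 - S l ^+ 2)) * (if (i < d)%N then S i else 1)
  else 0.

(** The first non-zero parameter gives a non-zero entry, as the factors before it are 1; if there is
    none, the last entry is 1. *)
Lemma polar_neq0 S d : exists2 i, (i <= d)%N & polar S d i != 0.
Proof.
have [[i id Si]|h] := pselect (exists2 i, (i < d)%N & S i != 0); last first.
  exists d => //; rewrite /polar leqnn ltnn mulr1; apply/prodf_neq0 => l _.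
  rewrite (_ : S l = 0) ?expr0n ?subr0 ?oner_eq0//.
  by apply/eqP; apply: contrapT => /negP Sl; apply: h; exists l.
have ex : exists i, (i < d)%N && (S i != 0) by exists i; rewrite id.
case: (ex_minnP ex) => j /andP[jd Sj] jmin; exists j; first exact: ltnW.
rewrite /polar (ltnW jd) jd mulf_neq0//; apply/prodf_neq0 => l _.
rewrite (_ : S l = 0) ?expr0n ?subr0 ?oner_eq0//.
apply/eqP; apply: contraTT (ltn_ord l) => Sl; rewrite -leqNgt; apply: jmin.
by rewrite Sl andbT (ltn_trans (ltn_ord l)).
Qed.

Lemma polar_gt S d i : (d < i)%N -> polar S d i = 0.
Proof. by move=> di; rewrite /polar leqNgt di. Qed.

(** The factor [1 - S j ^+ 2] kills all later entries, so the parameters after [j] have no effect on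
    this facet. *)
Lemma polar_facet_gt S d i j : (j < d)%N -> `|S j| = 1 -> (j < i)%N ->
  polar S d i = 0.
Proof.
move=> jd Sj ji; rewrite /polar; case: (leqP i d) => // id.
by rewrite (bigD1 (Ordinal ji)) //= -real_normK ?num_real// Sj expr1n subrr !mul0r.
Qed.

Lemma polar_facet S S' c d j : (j < d)%N -> `|S j| = 1 -> c ^+ 2 = 1 ->
  (forall l, (l <= j)%N -> S' l = c * S l) ->
  forall i, polar S' d i = c * polar S d i.
Proof.
move=> jd Sj c1 SS' i; case: (leqP i j) => ij; last first.
  rewrite !(@polar_facet_gt _ _ _ j) ?mulr0// SS'// normrM Sj mulr1.
  by apply/eqP; rewrite -sqrp_eq1// -normrX c1 normr1.
rewrite /polar (leq_trans ij (ltnW jd)) (leq_ltn_trans ij jd) SS'// mulrCA.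
congr (_ * (_ * _)); apply: eq_bigr => l _.
by rewrite SS' ?exprMn ?c1 ?mul1r// (leq_trans _ ij)// ltnW.
Qed.

Lemma polar_first S d : (0 < d)%N -> polar S d 0 = S 0%N.
Proof. by move=> d0; rewrite /polar d0 big_ord0 mul1r. Qed.

Lemma polar0 S d : d = 0%N -> polar S d 0 = 1.
Proof. by move=> ->; rewrite /polar big_ord0 mul1r. Qed.

Lemma eq_polar S S' d i :
  (forall l, (l < d)%N -> S' l = S l) -> polar S' d i = polar S d i.
Proof.
move=> e; rewrite /polar; case: (leqP i d) => // id; congr (_ * _).
  by apply: eq_bigr => l _; rewrite e// (leq_trans (ltn_ord l)).
by case: ifP => // /e.
Qed.

(** The first parameter enters the later entries only through its square. *)
Lemma polar_flip_first S S' d i : S' 0%N = - S 0%N ->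
  (forall l, (0 < l < d)%N -> S' l = S l) -> (0 < i)%N ->
  polar S' d i = polar S d i.
Proof.
move=> S0 Sl i0; rewrite /polar; case: (leqP i d) => // id; congr (_ * _).
  apply: eq_bigr => -[[|l] li] _ /=; first by rewrite S0 sqrrN.
  by rewrite Sl// (leq_trans li).
by case: ifP => // id'; rewrite Sl// i0.
Qed.

Lemma polar_base S d i : ((0 < d)%N -> S 0%N = 1) -> polar S d i = (i == 0%N)%:R.
Proof.
case: d => [_|d /(_ isT) S0]; case: i => [|i] /=.
- exact: polar0.
- exact: polar_gt.
- by rewrite polar_first.
- by rewrite (@polar_facet_gt _ _ _ 0%N)// S0 normr1.
Qed.

Lemma continuous_polar (T : topologicalType) (S : T -> nat -> R) d i :
  (forall l, continuous (fun s => S s l)) -> continuous (fun s => polar (S s) d i).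
Proof.
move=> cS; rewrite /polar; case: (leqP i d) => _; last exact: cst_continuous.
move=> s; apply: cvgM; last first.
  by case: ifP => _; [exact: cS | exact: cvg_cst].
elim: i => [|i IH].
  rewrite big_ord0; under eq_fun do rewrite big_ord0; exact: cvg_cst.
rewrite big_ord_recr; under eq_fun do rewrite big_ord_recr.
apply: cvgM => //; apply: cvgB; first exact: cvg_cst.
by rewrite expr2; under eq_fun do rewrite expr2; apply: cvgM; exact: cS.
Qed.

End Polar.

(** * The topology of the Grassmannian *)

Section GrassmannianTopology.
Context {R : realType} {n k : nat}.
Implicit Types (L : grassmannian R n k).

Lemma subspace_of_inj : injective (@subspace_of R n k).
Proof. by move=> L L' /val_inj. Qed.

(** A subspace is the set of fixed vectors of its projection. *)
Lemma orth_proj_inj L L' :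
  orth_proj (subspace_of L) = orth_proj (subspace_of L') -> L = L'.
Proof.
move=> e; apply: subspace_of_inj; apply/vspaceP => x.
have memE (M : {vspace 'rV[R]_n}) : (x \in M) = (x *m orth_proj M == x).
  apply/idP/eqP => [|<-]; first exact: orth_proj_id.
  exact: (orth_projP M x).1.
by rewrite !memE e.
Qed.

Lemma orth_proj_continuous :
  continuous (fun L => orth_proj (subspace_of L) : 'M[R]_n).
Proof. exact: initial_continuous. Qed.

Lemma continuous_matrix (T : topologicalType) (p q : nat) (f : T -> 'M[R]_(p, q)) :
  (forall i j, continuous (fun t => f t i j)) -> continuous f.
Proof.
move=> cf t U [P fP PU].
have : \forall t' \near t, forall ij : 'I_p * 'I_q, P ij.1 ij.2 (f t' ij.1 ij.2).
  apply: (@filter_forall _ _ (fun ij t' => P ij.1 ij.2 (f t' ij.1 ij.2)) (nbhs t)).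
  by move=> ij; apply: cf; exact: fP.
by apply: filterS => t' h; apply: PU => i j; exact: (h (i, j)).
Qed.

Lemma continuous_grassmannian (T : topologicalType) (c : T -> grassmannian R n k) :
  (forall i j, continuous (fun t => orth_proj (subspace_of (c t)) i j)) ->
  continuous c.
Proof.
move=> cc t U /nbhs_ballP[e /= e0 eU].
have := @continuous_matrix _ _ _ (fun t => orth_proj (subspace_of (c t))) cc t.
move=> /(_ _ (nbhsx_ballx _ _ e0)).
by move=> h; apply: (@filterS _ (nbhs t) _ _ _ _ h) => t' h'; apply: eU.
Qed.

Lemma grassmannian_separated L L' : L <> L' ->
  exists U W, [/\ nbhs L U, nbhs L' W & forall M, U M -> W M -> False].
Proof.
move=> LL'.
have : ~ cluster (nbhs (orth_proj (subspace_of L))) (orth_proj (subspace_of L')).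
  by move=> /norm_hausdorff /orth_proj_inj.
rewrite clusterE => h; apply: contrapT => h'; apply: h => A LA B L'B.
apply: contrapT => h; apply: h'.
exists ((fun L => orth_proj (subspace_of L)) @^-1` A),
  ((fun L => orth_proj (subspace_of L)) @^-1` B); split.
- exact: orth_proj_continuous LA.
- exact: orth_proj_continuous L'B.
- by move=> M AM BM; apply: h; exists (orth_proj (subspace_of M)).
Qed.

End GrassmannianTopology.

(** * The [(k + 1)]-spaces that contain the last [k] coordinate axes *)

Section Family.
Context {R : realType} {m k : nat}.
Let n := (m + k).+1.
Implicit Types (s x : 'rV[R]_n).

Definition coordinate s (i : nat) : R := s 0 (inord i).

(** The first [m] parameters of the cube give a direction in the first [m + 1] coordinates, the next
    [k] a direction in the space of dimension [k + 1] that it spans with the last [k] axes. The last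
    parameter is a signed radius. *)
Definition line s (j : nat) : R := polar (coordinate s) m j.

Definition radial s (i : nat) : R := polar (fun l => coordinate s (m + l)) k i.

Definition family_mx s : 'M[R]_(k.+1, n) :=
  \matrix_(i, j) if i == 0 :> nat then line s j else (j == m + i :> nat)%:R.

Definition family s : {vspace 'rV[R]_n} := limg (linfun (mulmxr (family_mx s))).

Definition point s : 'rV[R]_n := (\row_i radial s i) *m family_mx s.

Lemma line_gt s j : (m < j)%N -> line s j = 0.
Proof. exact: polar_gt. Qed.

Lemma line_neq0 s : exists j : 'I_n, line s j != 0.
Proof.
have [j jm lj] := polar_neq0 (coordinate s) m.
have jn : (j < n)%N by rewrite ltnS (leq_trans jm)// leq_addr.
by exists (Ordinal jn).
Qed.

Lemma mul_family_mx s (c : 'rV[R]_k.+1) (j : 'I_n) : (c *m family_mx s) 0 j =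
  if (j <= m)%N then c 0 0 * line s j else c 0 (inord (j - m)).
Proof.
rewrite mxE big_ord_recl mxE /=; case: leqP => jm.
  rewrite big1 ?addr0// => i _; rewrite mxE /=.
  by rewrite (_ : (_ == _) = false) ?mulr0//; apply/negbTE; rewrite /bump; lia.
have jk : (j - m.+1 < k)%N by have jn : (j < (m + k).+1)%N := ltn_ord j; lia.
rewrite line_gt// mulr0 add0r (bigD1 (Ordinal jk))//= big1 ?addr0.
  rewrite mxE /= (_ : (_ == _) = true) ?mulr1; last by rewrite /bump /=; lia.
  by congr (c _ _); apply: val_inj; rewrite /= inordK /bump; lia.
move=> i ij; rewrite mxE /= (_ : (_ == _) = false) ?mulr0//.
apply/negbTE; apply: contra ij; rewrite -(inj_eq val_inj) /= /bump; lia.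
Qed.

Lemma mem_familyE s x : reflect (exists c : 'rV[R]_k.+1, x = c *m family_mx s)
  (x \in family s).
Proof.
rewrite /family; apply: (iffP memv_imgP) => [[c _ ->]|[c ->]]; exists c.
- by rewrite lfunE.
- exact: memvf.
- by rewrite lfunE.
Qed.

Lemma mem_family s x : (x \in family s) <->
  exists a : R, forall j : 'I_n, (j <= m)%N -> x 0 j = a * line s j.
Proof.
split=> [/mem_familyE[c ->]|[a xa]].
  by exists (c 0 0) => j jm; rewrite mul_family_mx jm.
apply/mem_familyE.
exists (\row_(i < k.+1) if i == 0 :> nat then a else x 0 (inord (m + i))).
apply/rowP => j; rewrite mul_family_mx; case: leqP => jm; first by rewrite xa// !mxE.
have jn : (j < (m + k).+1)%N := ltn_ord j.
rewrite mxE inordK ?ifN; last first.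
- lia.
- lia.
by congr (x _ _); apply: val_inj; rewrite /= inordK; lia.
Qed.

Lemma dim_family s : \dim (family s) == k.+1.
Proof.
rewrite /family limg_dim_eq ?dimvf /dim /= ?mul1n//.
apply/eqP; rewrite -subv0; apply/subvP => c; rewrite memv_cap => /andP[_].
rewrite memv_ker lfunE /= => /eqP/rowP c0; rewrite memv0; apply/eqP/rowP => i.
rewrite mxE; case: (posnP i) => [i0|i0].
  have [j lj] := line_neq0 s.
  have jm : (j <= m)%N by rewrite leqNgt; apply: contra lj => /line_gt ->.
  have := c0 j; rewrite mul_family_mx jm mxE => /eqP.
  rewrite mulf_eq0 (negbTE lj) orbF => /eqP <-.
  by congr (c _ _); apply: val_inj.
have := ltn_ord i => ik.
have := c0 (inord (m + i)); rewrite mul_family_mx mxE inordK; last by rewrite /n; lia.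
rewrite ifN; last by lia.
by move=> <-; congr (c _ _); apply: val_inj; rewrite /= inordK; lia.
Qed.

Definition family_gr s : grassmannian R n k.+1 :=
  (exist _ (family s) (dim_family s) : subspaces R n k.+1).

Lemma subspace_of_family s : subspace_of (family_gr s) = family s.
Proof. by []. Qed.

Lemma family_gr_eq s t c : c != 0 ->
  (forall j, line t j = c * line s j) -> family_gr t = family_gr s.
Proof.
move=> c0 e; apply: subspace_of_inj; rewrite !subspace_of_family.
apply/vspaceP => x; apply/idP/idP => /mem_family[a xa]; apply/mem_family.
  by exists (a * c) => j jm; rewrite xa// e mulrA.
by exists (a / c) => j jm; rewrite xa// e mulrA divfK.
Qed.

Lemma point_family s : point s \in family s.
Proof. by apply/mem_familyE; eexists. Qed.

Lemma pointE s (j : 'I_n) : point s 0 j =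
  if (j <= m)%N then radial s 0 * line s j else radial s (j - m).
Proof.
rewrite mul_family_mx !mxE; case: leqP => // jm; rewrite inordK//.
by have jn : (j < (m + k).+1)%N := ltn_ord j; lia.
Qed.

(** A change of sign of the line can be compensated by the radial coordinate of index 0, which
    multiplies it. *)
Lemma point_scale s t c d :
  (forall j, line t j = c * line s j) -> radial t 0 * c = d * radial s 0 ->
  (forall i, (0 < i)%N -> radial t i = d * radial s i) -> point t = d *: point s.
Proof.
move=> tl t0 ti; apply/rowP => j; rewrite [RHS]mxE !pointE; case: leqP => jm.
  by rewrite tl mulrA t0 mulrA.
by rewrite ti// subn_gt0.
Qed.

Lemma point_neq0 s : point s != 0.
Proof.
have [i ik ri] := polar_neq0 (fun l => coordinate s (m + l)) k.
apply/eqP => /rowP p0; case: (posnP i) => [i0|i0].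
  have [j lj] := line_neq0 s.
  have jm : (j <= m)%N by rewrite leqNgt; apply: contra lj => /line_gt ->.
  have := p0 j; rewrite pointE jm mxE => /eqP; rewrite mulf_eq0 (negbTE lj) orbF.
  by rewrite -i0; apply/negP.
have mi : (m + i < n)%N by rewrite /n; lia.
have := p0 (Ordinal mi); rewrite pointE /= ifN; last by lia.
by rewrite addKn mxE => /eqP; apply/negP.
Qed.

Lemma continuous_coordinate l : continuous (fun s => coordinate s l).
Proof. exact: coord_continuous. Qed.

Lemma continuous_line j : continuous (fun s => line s j).
Proof. by apply: continuous_polar => l; exact: continuous_coordinate. Qed.

Lemma continuous_radial j : continuous (fun s => radial s j).
Proof. by apply: continuous_polar => l; exact: continuous_coordinate. Qed.

Lemma continuous_point : continuous point.
Proof.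
apply: continuous_matrix => i j; rewrite ord1.
rewrite (_ : (fun t => _) = fun t => if (j <= m)%N then radial t 0 * line t j
    else radial t (j - m)); last by apply/funext => t; rewrite pointE.
case: leqP => _; last exact: continuous_radial.
by apply: continuous_mul; [exact: continuous_radial | exact: continuous_line].
Qed.

Definition line_sq s : R := \sum_(j < n) line s j ^+ 2.

Lemma line_sq_neq0 s : line_sq s != 0.
Proof.
have [j lj] := line_neq0 s; rewrite gt_eqF// /line_sq (bigD1 j)//=.
rewrite ltr_pwDl ?exprn_even_gt0// ?sumr_ge0// => i _; exact: sqr_ge0.
Qed.

(** The projection is the identity on the last [k] coordinates and the projection onto the line on
    the others. The formula makes continuity evident. *)
Lemma orth_proj_family s (a b : 'I_n) : orth_proj (family s) a b =
  if (b <= m)%N then line s a / line_sq s * line s b else (a == b)%:R.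
Proof.
pose e : 'rV[R]_n := delta_mx 0 a.
pose y : 'rV[R]_n := \row_b if (b <= m)%N then line s a / line_sq s * line s b
  else (a == b)%:R.
transitivity ((e *m orth_proj (family s)) 0 b); first by rewrite /e -rowE [RHS]mxE.
rewrite (_ : e *m _ = y); first by rewrite mxE.
apply: orth_proj_uniq.
  by apply/mem_family; exists (line s a / line_sq s) => j jm; rewrite mxE jm.
move=> z /mem_family[d zd]; apply/rowP => i; rewrite {i}ord1 !mxE.
rewrite (eq_bigr (fun j =>
  d * ((a == j)%:R * line s j - line s a / line_sq s * line s j ^+ 2))).
  rewrite -mulr_sumr big_split /= sumrN -mulr_sumr (bigD1 a)//= eqxx mul1r.
  rewrite big1 ?addr0 => [|j]; last by rewrite eq_sym => /negbTE ->; rewrite mul0r.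
  by rewrite -/(line_sq s) divfK ?line_sq_neq0// subrr mulr0.
move=> j _; rewrite !mxE eqxx /= [j == a]eq_sym; case: leqP => jm; last first.
  by rewrite line_gt// expr0n /= !mulr0 subrr mul0r subr0 mulr0.
by rewrite zd//; ring.
Qed.

Lemma continuous_family_gr : continuous family_gr.
Proof.
apply: continuous_grassmannian => a b.
rewrite (_ : (fun t => _) = fun t => if (b <= m)%N
    then line t a / line_sq t * line t b else (a == b)%:R); last first.
  by apply/funext => t; rewrite subspace_of_family orth_proj_family.
case: leqP => _; last exact: cst_continuous.
apply: continuous_mul; last exact: continuous_line.
apply: continuous_mul; first exact: continuous_line.
apply: continuous_inv; first exact: line_sq_neq0.
apply: continuous_sum => j; under eq_fun do rewrite expr2.
by apply: continuous_mul; exact: continuous_line.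
Qed.

End Family.

(** * Distances in the canonical bundle *)

Section Hulls.
Context {R : realType} {n : nat}.
Implicit Types (L : {vspace 'rV[R]_n}) (A : set 'rV[R]_n) (f : {scalar 'rV[R]_n}).

Lemma sub_convex_hull A : A `<=` convex_hull A.
Proof. by move=> x Ax C [_]; apply. Qed.

Lemma convex_hull_le A f M :
  (forall x, A x -> f x <= M) -> forall x, convex_hull A x -> f x <= M.
Proof.
move=> AM x xA; apply: (xA [set y | f y <= M]); split=> //= y z l.
rewrite !inE /= => yM zM.
rewrite -[conv l y z]/(l%:num *: (y : 'rV[R]_n) + (1 - l%:num) *: (z : 'rV[R]_n)).
rewrite linearD !linearZ /=.
have l0 : 0 <= l%:num by [].
have l1 : l%:num <= 1 by [].
nra.
Qed.

(** Moving from [p] in a direction in which [f] increases leaves the hull at once. *)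
Lemma max_boundary L A f M p : A `<=` [set` L] ->
  (exists2 v, v \in L & f v != 0) -> (forall x, A x -> f x <= M) -> A p -> f p = M ->
  boundary L (convex_hull A) p.
Proof.
move=> AL [v vL fv] AM Ap fp; split.
  by apply: subset_closure; exact: sub_convex_hull.
apply: (@closure_ray _ _ _ _ ((f v)^-1 *: v)) => t t0; split.
  by rewrite /= memvD ?memvZ//; exact: (AL p).
move=> /(convex_hull_le AM).
by rewrite linearD !linearZ /= mulVf// mulr1 fp; lra.
Qed.

(** A maximum point and a minimum point of [f] on the union are antipodal, so no member of the
    family contains both. *)
Lemma non_antipodal_extrema L (I : Type) (F : I -> set 'rV[R]_n) f i i' p p' :
  (forall j, F j `<=` [set` L]) -> non_antipodal L F ->
  (exists2 v, v \in L & f v != 0) ->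
  F i p -> (forall j x, F j x -> f x <= f p) ->
  F i' p' -> (forall j x, F j x -> f p' <= f x) ->
  (forall q, F i q -> f p' < f q) /\ (forall q, F i' q -> f q < f p).
Proof.
move=> FL nF [v vL fv] Fp pmax Fp' pmin.
have UL : \bigcup_j F j `<=` [set` L] by move=> x [l _]; exact: FL.
have Umax x : (\bigcup_j F j) x -> f x <= f p by move=> [l _]; exact: pmax.
have Umin x : (\bigcup_j F j) x -> (\- f) x <= (\- f) p'.
  by move=> [l _ Fx] /=; rewrite lerN2; exact: pmin Fx.
have Up : (\bigcup_j F j) p by exists i.
have Up' : (\bigcup_j F j) p' by exists i'.
have fvN : exists2 v, v \in L & (\- f) v != 0 by exists v => //=; rewrite oppr_eq0.
have anti x y : (\bigcup_j F j) x -> f x = f p -> (\bigcup_j F j) y -> f y = f p' ->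
    antipodal L (convex_hull (\bigcup_j F j)) x y.
  move=> Ux fx Uy fy; split.
  - by apply: max_boundary Ux fx => //; exists v.
  - apply: (max_boundary (f := \- f)) Uy _ => //=; last by rewrite fy.
  - exists f, (f p), ((\- f) p'); split.
    + split; [by exists v | exact: convex_hull_le | ].
      by exists p => //; exact: sub_convex_hull.
    + split; [by [] | exact: convex_hull_le | ].
      by exists p' => //; exact: sub_convex_hull.
    + by split=> //; exact: UL.
    + by split=> /=; [exact: UL | rewrite fy].
split=> q Fq; rewrite lt_neqAle.
  rewrite (pmin _ _ Fq) andbT eq_sym; apply/eqP => fq.
  by apply: (nF _ _ _ Fp Fq); apply: anti => //; exists i.
rewrite (pmax _ _ Fq) andbT; apply/eqP => fq.
by apply: (nF _ _ _ Fq Fp'); apply: anti => //; exists i'.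
Qed.

End Hulls.

(** * Nearby points from the Hausdorff distance *)

Section HausdorffDistance.
Context {R : realType} {n : nat}.
Implicit Types A B : set 'rV[R]_n.

Lemma hausdorff_dist_lt A B e : compact A -> compact B -> A !=set0 -> B !=set0 ->
  hausdorff_dist A B < e -> forall b, B b -> exists2 a, A a & ball b e a.
Proof.
move=> cA cB [a0 Aa0] [b0 Bb0] + b Bb.
have [MA [_ hA]] := compact_bounded cA; have [MB [_ hB]] := compact_bounded cB.
(* Both sets lie in the ball of radius [M], so [M + M + 1] is an admissible radius and the infimum
   is over a non-empty set. *)
pose M := `|MA| + `|MB| + 1.
have MMA : MA < M by rewrite /M; have := ler_norm MA; have := normr_ge0 MB; lra.
have MMB : MB < M by rewrite /M; have := ler_norm MB; have := normr_ge0 MA; lra.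
have M0 : 0 < M by rewrite /M; have := normr_ge0 MB; have := normr_ge0 MA; lra.
have AM x : A x -> `|x| <= M by exact: hA.
have BM x : B x -> `|x| <= M by exact: hB.
move=> /inf_lt[|r [r0 _ hr] re].
  exists (M + M + 1); split; first lra.
  - move=> x Ax; exists b0 => //; rewrite mx_norm_ball /ball_ /=.
    by apply: le_lt_trans (ler_normB _ _) _; have := AM _ Ax; have := BM _ Bb0; lra.
  - move=> x Bx; exists a0 => //; rewrite mx_norm_ball /ball_ /=.
    by apply: le_lt_trans (ler_normB _ _) _; have := AM _ Aa0; have := BM _ Bx; lra.
have [a Aa ab] := hr _ Bb; exists a => //.
by apply: ball_sym; apply: le_ball ab; exact: ltW.
Qed.

End HausdorffDistance.

(** * Semicontinuity of the fibres and continuity of the distances *)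

Section Bundle.
Context {R : realType} {n k : nat}.
Implicit Types (V : set (grassmannian R n k * 'rV[R]_n)) (L : grassmannian R n k).

Lemma compact_fiber V L : compact V -> compact (fiber_over V L).
Proof.
move=> /compact_near_coveringP cV; apply/compact_near_coveringP => I F P FF cover.
suff h : \near F, V `<=` (fun z => z.1 = L -> P F z.2).
  by apply: filterS h => i h y Vy; exact: (h (L, y)).
apply: cV => -[L' y] Vy.
have [LL'|LL'] := pselect (L = L'); last first.
    have [A [B [LA L'B AB]]] := grassmannian_separated LL'.
    exists (B `*` setT, setT).
      by split=> /=; [exists (B, setT) => //; split=> //; exact: filterT|exact: filterT].
    move=> [z i] /= [[Bz _] _] zL; exfalso; apply: (AB z.1) => //.
    by rewrite zL; exact: nbhs_singleton.
  rewrite -LL' in Vy *; have [[A B] /= [yA FB] AB] := cover y Vy.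
  exists (setT `*` A, B).
    by split=> //; exists (setT, A) => //; split=> //; exact: filterT.
  by move=> [z i] /= [[_ Az] Bi] _; exact: (AB (z.2, i)).
Qed.

(** Upper semicontinuity of the fibres, from compactness: since the Grassmannian is Hausdorff, the
    points of [V] near one over another space than [c t0] do not lie over [c t] for [t] near
    [t0]. *)
Lemma near_forall_fiber V (T : topologicalType) (c : T -> grassmannian R n k)
    (P : T -> 'rV[R]_n -> Prop) t0 :
  compact V -> continuous c ->
  (forall y, V (c t0, y) -> \forall p \near (t0, y), V (c p.1, p.2) -> P p.1 p.2) ->
  \forall t \near t0, forall y, V (c t, y) -> P t y.
Proof.
move=> /compact_near_coveringP/near_covering_withinP cV cc hP.
suff h : \forall t \near nbhs t0, V `<=` (fun z => z.1 = c t -> P t z.2).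
  by apply: filterS h => t h y Vy; exact: (h (c t, y)).
apply: cV => -[L y] Vy.
have [LL|LL] := pselect (c t0 = L); last first.
  have [A [B [LA L'B AB]]] := grassmannian_separated LL.
  exists (B `*` setT, c @^-1` A).
    split=> /=; last exact: cc.
    by exists (B, setT) => //; split=> //; exact: filterT.
  by move=> [z t] /= [[Bz _] At] _ zL; exfalso; apply: (AB z.1) => //; rewrite zL.
rewrite -LL in Vy *; have [[A B] /= [tA yB] AB] := hP y Vy.
exists (setT `*` B, A).
  by split=> //; exists (setT, B) => //; split=> //; exact: filterT.
move=> [[L' z] t] /= [[_ Bz] At] Vz zL; apply: (AB (t, z)) => //=.
by rewrite -zL.
Qed.

(** Lower semicontinuity of the fibres: by Hausdorff continuity, nearby fibres have points close to
    [y]. *)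
Lemma near_exists_fiber V (T : topologicalType) (c : T -> grassmannian R n k)
    (P : T -> 'rV[R]_n -> Prop) t0 y :
  compact V -> (forall L, fiber_over V L !=set0) ->
  (forall L0, hausdorff_dist (fiber_over V L) (fiber_over V L0) @[L --> L0] --> 0) ->
  continuous c -> V (c t0, y) ->
  (\forall p \near (t0, y), V (c p.1, p.2) -> P p.1 p.2) ->
  \forall t \near t0, exists2 y, V (c t, y) & P t y.
Proof.
move=> cV V0 hV cc Vy [[A B] /= [tA yB] AB].
have /nbhs_ballP[e /= e0 eB] := yB.
have /cvgrPdist_lt/(_ _ e0) : hausdorff_dist (fiber_over V L)
  (fiber_over V (c t0)) @[L --> c t0] --> 0 := hV (c t0).
move=> /cc h; apply: filterS2 tA h => t At /= h.
have [||||||z Vz yz] := @hausdorff_dist_lt R n (fiber_over V (c t))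
  (fiber_over V (c t0)) e _ _ _ _ _ y => //; try exact: compact_fiber.
  by apply: le_lt_trans h; rewrite sub0r normrN ler_norm.
by exists z => //; apply: (AB (t, z)) => //; split=> //=; exact: eB.
Qed.

Section Norms.
Context (N : grassmannian R n k -> 'rV[R]_n -> R).
Hypothesis N_continuous : {within canonical_bundle, continuous (fun p => N p.1 p.2)}.

Lemma near_norm (T : topologicalType) (c : T -> grassmannian R n k)
    (z : T -> 'rV[R]_n) t0 :
  {for t0, continuous c} -> {for t0, continuous z} -> z t0 \in subspace_of (c t0) ->
  forall e, 0 < e -> \forall t \near t0, z t \in subspace_of (c t) ->
    `|N (c t0) (z t0) - N (c t) (z t)| < e.
Proof.
move=> cc cz zc e e0.
move: N_continuous => /subspace_continuousP/(_ (c t0, z t0) zc).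
move=> /cvgrPdist_lt/(_ _ e0) h.
exact: (cvg_pair cc cz) h.
Qed.

Hypothesis N_norm : forall L, norm_on (subspace_of L) (N L).

Lemma near_norm_fiber V (T : topologicalType) (c : T -> grassmannian R n k)
    (z : T -> 'rV[R]_n) t0 (b : R) y e :
  V `<=` canonical_bundle -> continuous c -> continuous z ->
  (forall t, z t \in subspace_of (c t)) -> V (c t0, y) -> 0 < e ->
  \forall p \near (t0, y), V (c p.1, p.2) ->
    `|N (c t0) (z t0 + b *: y) - N (c p.1) (z p.1 + b *: p.2)| < e.
Proof.
move=> VB cc cz zc Vy e0.
have c1 : {for (t0, y), continuous (fun p : T * 'rV[R]_n => c p.1)}.
  by apply: (@continuous_comp _ _ _ fst c); [exact: cvg_fst | exact: cc].
have z1 : {for (t0, y), continuous (fun p : T * 'rV[R]_n => z p.1 + b *: p.2)}.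
  apply: (@cvgD R 'rV[R]_n); last first.
    by apply: (@cvgZ R 'rV[R]_n); [exact: cvg_cst | exact: cvg_snd].
  by apply: (@continuous_comp _ _ _ fst z); [exact: cvg_fst | exact: cz].
have := near_norm c1 z1 _ e0; rewrite /= memvD ?zc ?memvZ//; last exact: (VB _ Vy).
move=> /(_ isT); apply: filterS => -[t u] /= h Vu; apply: h.
by rewrite memvD ?zc// memvZ//; exact: (VB _ Vu).
Qed.

Lemma dist_to_le L x (A : set 'rV[R]_n) y : x \in subspace_of L ->
  A `<=` [set` subspace_of L] -> A y -> dist_to (N L) x A <= N L (x - y).
Proof.
move=> xL AL Ay; apply: (@inf_lb _ _ 0); last by exists y.
move=> r [u Au <-]; case: (N_norm L) => + _ _ _; apply.
by rewrite memvB//; exact: AL.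
Qed.

Lemma le_dist_to L x (A : set 'rV[R]_n) b : A !=set0 ->
  (forall y, A y -> b <= N L (x - y)) -> b <= dist_to (N L) x A.
Proof.
move=> [y Ay] bA; apply: lb_le_inf; first by exists (N L (x - y)), y.
by move=> r [u Au <-]; exact: bA.
Qed.

(** An almost nearest point persists in nearby fibres and bounds the distance from above; a lower
    bound on the whole fibre persists up to [e / 2]. *)
Lemma continuous_dist_to V (T : topologicalType) (c : T -> grassmannian R n k)
    (z : T -> 'rV[R]_n) :
  V `<=` canonical_bundle -> compact V -> (forall L, fiber_over V L !=set0) ->
  (forall L0, hausdorff_dist (fiber_over V L) (fiber_over V L0) @[L --> L0] --> 0) ->
  continuous c -> continuous z -> (forall t, z t \in subspace_of (c t)) ->
  continuous (fun t => dist_to (N (c t)) (z t) (fiber_over V (c t))).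
Proof.
move=> VB cV V0 hV cc cz zc t0; apply/cvgrPdist_lt => e e0.
have fB L : fiber_over V L `<=` [set` subspace_of L] by move=> y /VB.
set d := dist_to _ _ _.
have e20 : 0 < e / 2 by rewrite divr_gt0.
have nearN y := @near_norm_fiber V T c z t0 (-1) y (e / 2) VB cc cz zc.
have [y Vy yd] : exists2 y, V (c t0, y) & N (c t0) (z t0 - y) < d + e / 2.
  have : d < d + e / 2 by rewrite ltrDl.
  move=> /inf_lt[|r [y Vy <-] yd]; last by exists y.
  by have [u Vu] := V0 (c t0); exists (N (c t0) (z t0 - u)), u.
have up : \forall t \near t0, dist_to (N (c t)) (z t) (fiber_over V (c t)) < d + e.
  have : \forall p \near (t0, y), V (c p.1, p.2) ->
      N (c p.1) (z p.1 - p.2) < d + e.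
    apply: filterS (nearN y Vy e20) => -[t u] /= h Vu.
    by have := h Vu; rewrite !scaleN1r ltr_norml; lra.
  move=> /(@near_exists_fiber V T c (fun t u => N (c t) (z t - u) < d + e)
    t0 y cV V0 hV cc Vy).
  apply: filterS => t [u Vu]; apply: le_lt_trans; exact: dist_to_le.
have low : \forall t \near t0, d - e < dist_to (N (c t)) (z t) (fiber_over V (c t)).
  have : \forall t \near t0, forall u, V (c t, u) -> d - e / 2 <= N (c t) (z t - u).
    apply: near_forall_fiber => // u Vu.
    apply: filterS (nearN u Vu e20) => -[t v] /= h Vv.
    have du : d <= N (c t0) (z t0 - u) by apply: dist_to_le.
    by have := h Vv; rewrite !scaleN1r ltr_norml; lra.
  apply: filterS => t h; apply: lt_le_trans (le_dist_to (V0 (c t)) h); lra.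
by apply: filterS2 up low => t; rewrite ltr_norml; lra.
Qed.

End Norms.

End Bundle.

(** * Comparison of the distances at infinity *)

Lemma scalar_continuous {R : realType} {n : nat} (f : {scalar 'rV[R]_n}) :
  continuous f.
Proof.
rewrite (_ : (f : _ -> _) = fun x : 'rV[R]_n => \sum_i x 0 i * f (delta_mx 0 i)).
  apply: continuous_sum => i; apply: continuous_mul; last exact: cst_continuous.
  exact: coord_continuous.
apply/funext => x; rewrite {1}(row_sum_delta x) linear_sum.
by apply: eq_bigr => i _; rewrite linearZ.
Qed.

Section Asymptotics.
Context {R : realType} {n k p : nat}.
Context (N : grassmannian R n k -> 'rV[R]_n -> R).
Context (V : 'I_p.+1 -> set (grassmannian R n k * 'rV[R]_n)).
Hypothesis N_norm : forall L, norm_on (subspace_of L) (N L).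
Hypothesis N_smooth :
  forall L, smooth_body (subspace_of L) (unit_ball (subspace_of L) (N L)).
Hypothesis N_continuous : {within canonical_bundle, continuous (fun p => N p.1 p.2)}.
Hypothesis V_sub : forall i, V i `<=` canonical_bundle.
Hypothesis V_compact : forall i, compact (V i).
Hypothesis V_nonempty : forall i L, fiber_over (V i) L !=set0.
Hypothesis V_continuous : forall i L0,
  hausdorff_dist (fiber_over (V i) L) (fiber_over (V i) L0) @[L --> L0] --> 0.
Hypothesis V_non_antipodal : forall L : grassmannian R n k,
  non_antipodal (subspace_of L) (fun i => fiber_over (V i) L).

Definition fiber_dist i L x := dist_to (N L) x (fiber_over (V i) L).

Lemma fiber_sub i L : fiber_over (V i) L `<=` [set` subspace_of L].
Proof. by move=> y /V_sub. Qed.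

(** Here [x] and [y] are a maximum and a minimum point of [f] on the union, [M] is the maximum on
    [V j] and [a] the minimum on [V i]. *)
Lemma extremal_indices L (f : {scalar 'rV[R]_n}) :
  (exists2 v, v \in subspace_of L & f v != 0) ->
  exists i j x y M a, [/\ V i (L, x), V j (L, y) /\ M < f x, f y < a,
    forall z, V j (L, z) -> f z <= M & forall z, V i (L, z) -> a <= f z].
Proof.
move=> fv.
have cf A : {within A, continuous f}.
  by apply: continuous_subspaceT; exact: scalar_continuous.
have cV i := compact_fiber (L := L) (@V_compact i).
have emax i : exists y, V i (L, y) /\ forall z, V i (L, z) -> f z <= f y.
  have [y yV ymax] := compact_EVT_max (V_nonempty i L) (cV i) (cf _).
  by exists y; split=> [|z Vz]; [exact: set_mem yV | apply: ymax; exact: mem_set].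
have emin i : exists y, V i (L, y) /\ forall z, V i (L, z) -> f y <= f z.
  have [y yV ymin] := compact_EVT_min (V_nonempty i L) (cV i) (cf _).
  by exists y; split=> [|z Vz]; [exact: set_mem yV | apply: ymin; exact: mem_set].
have [P hP] := choice emax; have [Q hQ] := choice emin.
pose i := [arg max_(i > ord0) f (P i)]%O; pose j := [arg min_(i < ord0) f (Q i)]%O.
have imax l x : V l (L, x) -> f x <= f (P i).
  move=> /(hP l).2 h; apply: le_trans h _; rewrite /i.
  by case: arg_maxP => //= a _; apply.
have jmin l x : V l (L, x) -> f (Q j) <= f x.
  move=> /(hQ l).2; apply: le_trans; rewrite /j.
  by case: arg_minP => //= a _; apply.
have [hi hj] := @non_antipodal_extrema R n (subspace_of L) 'I_p.+1
  (fun i => fiber_over (V i) L) f i j (P i) (Q j) (@fiber_sub ^~ L) (@V_non_antipodal L)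
  fv (hP i).1 imax (hQ j).1 jmin.
exists i, j, (P i), (Q j), (f (P j)), (f (Q i)); split.
- exact: (hP i).1.
- by split; [exact: (hQ j).1 | apply: hj; exact: (hP j).1].
- by apply: hi; exact: (hQ i).1.
- exact: (hP j).2.
- exact: (hQ i).2.
Qed.

(** The indices are extremal for the derivative [f] of the norm at [u t0]. The required bounds are
    reached at one scale [b], where they pass to nearby [t]; the triangle inequality then carries
    them to all [r >= b]. *)
Lemma asymptotic_near (T : topologicalType) (c : T -> grassmannian R n k)
    (u : T -> 'rV[R]_n) t0 :
  continuous c -> continuous u -> (forall t, u t \in subspace_of (c t)) ->
  u t0 != 0 ->
  exists i j r0, \forall t \near t0, forall r, r0 <= r ->
    fiber_dist i (c t) (r *: u t) < fiber_dist j (c t) (r *: u t) /\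
    fiber_dist j (c t) (- (r *: u t)) < fiber_dist i (c t) (- (r *: u t)).
Proof.
move=> cc cu uc u0; pose L := c t0.
have [f [fu fle flt]] := smooth_norm_deriv (N_norm L) (N_smooth (L := L)) (uc t0) u0.
have [|i [j [x [y [M [a [Vx [Vy Mx] ya hM ha]]]]]]] := @extremal_indices L f.
  by exists (u t0) => //; rewrite fu gt_eqF// (norm_gt0 (N_norm L)).
(* Each comparison uses up two errors [e], less than the corresponding gap. *)
pose e := Num.min (f x - M) (a - f y) / 4.
have e0 : 0 < e by rewrite divr_gt0// lt_min !subr_gt0 Mx.
have [eM ea] : 4 * e <= f x - M /\ 4 * e <= a - f y.
  by split; rewrite mulrC divfK ?pnatr_eq0// ge_min lexx ?orbT.
have Nc d : 0 < d -> \forall v \near (0 : 'rV[R]_n), v \in subspace_of L -> N L v < d.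
  move=> d0; have h := @near_norm R n k N N_continuous 'rV[R]_n (fun=> L) id 0
    (@cst_continuous _ _ L (0 : 'rV[R]_n)) cvg_id (mem0v _) d d0.
  have N0 : N L 0 = 0.
    by rewrite -(scale0r (0 : 'rV[R]_n)) (norm_scale (N_norm L)) ?mem0v// mul0r.
  apply: (@filterS _ (nbhs (0 : 'rV[R]_n)) _ _ _ _ h) => v {}h /h.
  rewrite /= N0 sub0r normrN; apply: le_lt_trans.
  exact: ler_norm.
pose E (b : R) A m := forall z, A z -> N L (b *: u t0 + z) - b * N L (u t0) < m.
have unif A m : compact A -> A `<=` [set` subspace_of L] -> (forall z, A z -> f z <= m) ->
    \forall b \near +oo, E b A (m + e).
  move=> cA AL Am.
  exact: (smooth_norm_deriv_uniform (N_norm L) (uc t0) Nc fle flt cA AL Am e0).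
have xL : x \in subspace_of L := V_sub Vx.
have yL : y \in subspace_of L := V_sub Vy.
have cVj : compact (fiber_over (V j) L) := compact_fiber (@V_compact j).
have cVi : compact (-%R @` fiber_over (V i) L).
  apply: continuous_compact; last exact: compact_fiber.
  by apply: continuous_subspaceT; exact: opp_continuous.
(* The bounds over whole fibres will give lower bounds of distances, and those at the single points
   [- x] and [y] upper bounds. *)
have h1 := unif _ M cVj (@fiber_sub _ _) hM.
have h2 : \forall b \near +oo, E b (-%R @` fiber_over (V i) L) (- a + e).
  apply: unif => // [z [w Vw <-]|z [w Vw <-]]; first by rewrite /= memvN (V_sub Vw).
  by rewrite linearN lerN2; exact: ha.
have h3 : \forall b \near +oo, E b [set - x] (- f x + e).
  by apply: unif => [|_ ->|_ ->]; [exact: compact_set1|rewrite /= memvN|rewrite linearN].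
have h4 : \forall b \near +oo, E b [set y] (f y + e).
  by apply: unif => [|_ ->|_ ->]; [exact: compact_set1| |].
have [b [[[b1 b2] [b3 b4]] b0]] := filter_ex (filterI (filterI (filterI h1 h2)
  (filterI h3 h4)) (nbhs_pinfty_ge (num_real (0 : R)))).
exists i, j, b.
pose w t := b *: u t.
have cw : continuous w.
  by apply: continuous_scale => //; exact: cst_continuous.
have wc t : w t \in subspace_of (c t) by rewrite memvZ.
pose gap t (s : R) z := N (c t) (w t + s *: z) - b * N (c t) (u t).
have near_gap l (s : R) z m : V l (L, z) -> gap t0 s z < m ->
    \forall q \near (t0, z), V l (c q.1, q.2) -> gap q.1 s q.2 < m.
  move=> Vz zm; pose d := (m - gap t0 s z) / 2.
  have d0 : 0 < d by rewrite divr_gt0// subr_gt0.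
  have n1 := near_norm_fiber N_continuous s (@V_sub l) cc cw wc Vz d0.
  have n2 := near_norm_fiber N_continuous 0 (@V_sub l) cc cw wc Vz d0.
  apply: filterS2 n1 n2 => -[t v] /= k1 k2 Vv.
  have := k1 Vv; have := k2 Vv; rewrite !scale0r !addr0 /gap.
  rewrite !(norm_scale (N_norm _))// !ltr_norml /d /gap.
  move: (N (c t0) (w t0 + _)) (N (c t) (w t + _)) => A B.
  move: (b * _) (b * _) => C D; lra.
have near_all l (s : R) m : (forall z, V l (L, z) -> gap t0 s z < m) ->
    \forall t \near t0, forall z, V l (c t, z) -> gap t s z < m.
  move=> hm; apply: near_forall_fiber => // z Vz; apply: near_gap => //; exact: hm.
have near_ex l (s : R) z m : V l (L, z) -> gap t0 s z < m ->
    \forall t \near t0, exists2 z, V l (c t, z) & gap t s z < m.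
  by move=> Vz zm; apply: (near_exists_fiber _ _ _ _ Vz) => //; exact: near_gap.
have n1 : \forall t \near t0, forall z, V j (c t, z) -> gap t 1 z < M + e.
  by apply: near_all => z Vz; rewrite /gap scale1r; exact: b1.
have n2 : \forall t \near t0, forall z, V i (c t, z) -> gap t (-1) z < - a + e.
  by apply: near_all => z Vz; rewrite /gap scaleN1r; apply: b2; exists z.
have n3 : \forall t \near t0, exists2 z, V i (c t, z) & gap t (-1) z < - f x + e.
  by apply: (near_ex i (-1) x) => //; rewrite /gap scaleN1r; exact: b3.
have n4 : \forall t \near t0, exists2 z, V j (c t, z) & gap t 1 z < f y + e.
  by apply: (near_ex j 1 y) => //; rewrite /gap scale1r; exact: b4.
apply: filterS (filterI (filterI n1 n2) (filterI n3 n4)).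
move=> t [[m1 m2] [[x' Vx' xm] [y' Vy' ym]]] r br.
have r0 : 0 <= r := le_trans b0 br.
have [N0 _ NZ tri] := N_norm (c t).
have ut := uc t.
pose nu := N (c t) (u t).
have ruL : r *: u t \in subspace_of (c t) by rewrite memvZ.
have nu_r s : 0 <= s -> N (c t) (s *: u t) = s * nu by exact: norm_scale.
(* Two applications of the triangle inequality bound the increments of the
   norm at [r *: u t] by those at [b *: u t]. *)
have lower s z : z \in subspace_of (c t) -> r * nu - gap t s z <=
    N (c t) (r *: u t - s *: z).
  move=> zL.
  have := tri (r *: u t - s *: z) (w t + s *: z).
  rewrite !(memvB, memvD, memvZ)// => /(_ isT isT).
  rewrite addrACA addNr addr0 -scalerDl nu_r ?addr_ge0// /gap -/nu; lra.
have upper s z : z \in subspace_of (c t) ->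
    N (c t) (r *: u t + s *: z) <= r * nu + gap t s z.
  move=> zL.
  have := tri ((r - b) *: u t) (w t + s *: z).
  rewrite !(memvD, memvZ)// => /(_ isT isT).
  rewrite addrA -scalerDl subrK nu_r ?subr_ge0// /gap -/nu; lra.
have fd_opp l z : V l (c t, z) -> N (c t) (- (r *: u t) - z) = N (c t) (r *: u t + z).
  move=> Vz; rewrite -opprD (norm_opp (N_norm (c t)))// memvD//.
  exact: V_sub Vz.
split.
  apply: (@le_lt_trans _ _ (r * nu - f x + e)).
    apply: le_trans (dist_to_le N_norm ruL (@fiber_sub _ _) Vx') _.
    by have := upper (-1) x' (V_sub Vx'); rewrite scaleN1r; lra.
  apply: (@lt_le_trans _ _ (r * nu - (M + e))); first lra.
  apply: le_dist_to => // z Vz.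
  by have := lower 1 z (V_sub Vz); rewrite scale1r; have := m1 z Vz; lra.
apply: (@le_lt_trans _ _ (r * nu + f y + e)).
  have nruL : - (r *: u t) \in subspace_of (c t) by rewrite memvN.
  apply: le_trans (dist_to_le N_norm nruL (@fiber_sub _ _) Vy') _.
  rewrite (fd_opp _ _ Vy').
  by have := upper 1 y' (V_sub Vy'); rewrite scale1r; lra.
apply: (@lt_le_trans _ _ (r * nu - (- a + e))); first lra.
apply: le_dist_to => // z Vz; rewrite (fd_opp _ _ Vz).
have := lower (-1) z (V_sub Vz); rewrite scaleN1r opprK.
by have := m2 z Vz; lra.
Qed.

End Asymptotics.

(** * Symmetries of the parametrization *)

Section Symmetries.
Context {R : realType} {m k : nat}.
Let n := (m + k).+1.
Let nE : n = (m + k).+1 := erefl.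
Implicit Types (s t : 'rV[R]_n).

Definition radius s : R := coordinate s (m + k).

Definition scaled_point s : 'rV[R]_n := radius s *: point s.

Lemma coordinate_negate (P : pred nat) s i : (i < n)%N ->
  coordinate (negate (fun l : 'I_n => P l) s) i =
  if P i then - coordinate s i else coordinate s i.
Proof. by move=> i_n; rewrite /coordinate mxE inordK. Qed.

Lemma coordinate_erase (e : 'I_n) s i : (i < n)%N -> i != e ->
  coordinate (erase e s) i = coordinate s i.
Proof.
move=> i_n ie; rewrite /coordinate mxE ifN//.
by apply: contra ie => /eqP <-; rewrite inordK.
Qed.

Lemma facet_coordinate1 d j s i : facet d j s -> (d <= i < n)%N -> coordinate s i = 1.
Proof. by move=> [_ h _] /andP[di i_n]; apply: h; rewrite inordK. Qed.

Lemma facet_coordinateN d j s : facet d j s -> `|coordinate s j| = 1.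
Proof. by move=> [_ _ h]; rewrite /coordinate inord_val. Qed.

(** The boundary symmetry lies over the same space and takes the point to its opposite; its form
    depends on the group of parameters to which [j] belongs. *)
Lemma odd_symmetry (j : 'I_n) : exists P : pred 'I_n,
  [/\ P j, forall i, P i -> (i <= j)%N &
    forall s, facet j.+1 j s ->
      [/\ family_gr (negate P s) = family_gr s,
          scaled_point (negate P s) = - scaled_point s,
          `|radius s| = 1 & `|radius (negate P s)| = 1] ].
Proof.
have jn : (j < (m + k).+1)%N := ltn_ord j.
have mkn : (m + k < n)%N by [].
(* Negating the line parameters up to [j] reverses the line. All later parameters are 1, so the
   radial vector is the first basis vector and the radius is 1. *)
have [jm|mj] := ltnP j m.
  exists (fun i : 'I_n => (i <= j)%N); split=> // s fs.
  set t := negate _ s.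
  have ct i : (i < n)%N -> coordinate t i =
      if (i <= j)%N then - coordinate s i else coordinate s i.
    exact: (@coordinate_negate (fun i => (i <= j)%N)).
  have tl i : line t i = -1 * line s i.
    apply: (@polar_facet _ _ _ _ _ j) => //; first exact: facet_coordinateN fs.
      by rewrite sqrrN expr1n.
    by move=> l lj; rewrite ct ?lj ?mulN1r//; lia.
  have s1 i : (j < i < n)%N -> coordinate s i = 1 by exact: facet_coordinate1 fs.
  have t1 i : (j < i < n)%N -> coordinate t i = 1.
    by move=> ji; rewrite ct ?ifN ?s1//; lia.
  have sr i : radial s i = (i == 0%N)%:R.
    by apply: polar_base => k0; apply: s1; lia.
  have tr i : radial t i = (i == 0%N)%:R.
    by apply: polar_base => k0; apply: t1; lia.
  have rs : radius s = 1 by apply: s1; lia.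
  have rt : radius t = 1 by apply: t1; lia.
  split; rewrite ?rs ?rt ?normr1//.
    by apply: (@family_gr_eq _ _ _ _ _ (-1)) => //; rewrite oppr_eq0 oner_eq0.
  rewrite /scaled_point rs rt !scale1r -scaleN1r; apply: (@point_scale _ _ _ _ _ (-1)) => //.
    by rewrite sr tr mulrC.
  by move=> i i0; rewrite sr tr gtn_eqF// mulr0.
(* For the last parameter the radius is negated; otherwise the radial parameters from [m] to [j]
   are, which reverses the radial vector while the radius is 1. *)
have [jmk|] := ltnP j (m + k); last first.
  move=> mkj; have jE : j = m + k :> nat by apply/eqP; rewrite eqn_leq mkj -ltnS jn.
  exists (fun i : 'I_n => (i == m + k :> nat)%N); split=> [|i /eqP ->|s fs].
  - by rewrite jE.
  - by rewrite jE.
  set t := negate _ s.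
  have ct i : (i < n)%N -> coordinate t i =
      if (i == m + k)%N then - coordinate s i else coordinate s i.
    exact: (@coordinate_negate (fun i => (i == m + k)%N)).
  have tl i : line t i = 1 * line s i.
    by rewrite mul1r; apply: eq_polar => l lm; rewrite ct ?ifN//; lia.
  have tr i : radial t i = 1 * radial s i.
    by rewrite mul1r; apply: eq_polar => l lm; rewrite ct ?ifN//; lia.
  have rt : radius t = - radius s by rewrite /radius ct// eqxx.
  have rs : `|radius s| = 1 by have := facet_coordinateN fs; rewrite jE.
  split; rewrite ?rt ?normrN//.
    by apply: (@family_gr_eq _ _ _ _ _ 1) => //; rewrite oner_eq0.
  rewrite /scaled_point rt scaleNr; congr (- (_ *: _)).
  by rewrite -[RHS]scale1r; apply: (@point_scale _ _ _ _ _ 1) => //; rewrite tr mulr1.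
exists (fun i : 'I_n => (m <= i <= j)%N); split=> [|i /andP[]//|s fs].
  by rewrite mj leqnn.
set t := negate _ s.
have ct i : (i < n)%N -> coordinate t i =
    if (m <= i <= j)%N then - coordinate s i else coordinate s i.
  exact: (@coordinate_negate (fun i => (m <= i <= j)%N)).
have tl i : line t i = 1 * line s i.
  by rewrite mul1r; apply: eq_polar => l lm; rewrite ct ?ifN//; lia.
have tr i : radial t i = -1 * radial s i.
  apply: (@polar_facet _ _ _ _ _ (j - m)).
  - lia.
  - by rewrite subnKC//; exact: facet_coordinateN fs.
  - by rewrite sqrrN expr1n.
  - by move=> l lj; rewrite ct ?ifT ?mulN1r//; lia.
have rs : radius s = 1 by apply: (facet_coordinate1 fs); lia.
have rt : radius t = 1 by rewrite /radius ct ?ifN//; lia.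
split; rewrite ?rs ?rt ?normr1//.
  by apply: (@family_gr_eq _ _ _ _ _ 1) => //; rewrite oner_eq0.
rewrite /scaled_point rs rt !scale1r -scaleN1r.
by apply: (@point_scale _ _ _ _ _ 1) => //; rewrite tr mulr1.
Qed.

Definition same_fibre_point s t := [/\ family_gr t = family_gr s,
  scaled_point t = scaled_point s & `|radius t| = `|radius s|].

Lemma same_fibre_pointI s t c d : c != 0 -> d ^+ 2 = 1 ->
  (forall j, line t j = c * line s j) -> radial t 0 * c = d * radial s 0 ->
  (forall i, (0 < i)%N -> radial t i = d * radial s i) ->
  radius t = d * radius s -> same_fibre_point s t.
Proof.
move=> c0 d1 tl t0 ti rt; split; first exact: family_gr_eq tl.
  by rewrite /scaled_point rt (point_scale tl t0 ti) scalerA mulrAC -expr2 d1 mul1r.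
rewrite rt normrM (_ : `|d| = 1) ?mul1r//.
by apply/eqP; rewrite -sqrp_eq1// -normrX d1 normr1.
Qed.

(** Polar coordinates ignore the parameters of their group after one equal to 1 or -1. If [j] is not
    the last of its group, a later one can be erased. If it is, negating the group reverses its
    vector, and the sign is compensated in the next group. *)
Lemma facet_symmetry d (j : 'I_n) : (j.+1 < d <= n)%N ->
  (exists e : 'I_n, [/\ (e < d)%N, e != j &
     forall s, facet d j s -> same_fibre_point s (erase e s)]) \/
  (exists P : pred 'I_n, [/\ P j, forall i, P i -> (i < d)%N &
     forall s, facet d j s -> same_fibre_point s (negate P s)]).
Proof.
move=> /andP[jd]; rewrite {1}/n => dn.
have sq1 : (1 : R) ^+ 2 = 1 by rewrite expr1n.
have sqN1 : (-1 : R) ^+ 2 = 1 by rewrite sqrrN expr1n.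
have n10 : -1 != 0 :> R by rewrite oppr_eq0 oner_eq0.
have [jm|mj] := ltnP j m.
  case: (ltngtP j.+1 m) => [jm1|mj1|jm1]; last 2 first.
  - by move: jm; rewrite ltnNge -ltnS mj1.
  - right; exists (fun i : 'I_n => (i <= m)%N); split=> [|i im|s fs].
    + lia.
    + by apply: leq_ltn_trans im _; rewrite -jm1.
    set t := negate _ s.
    have ct i : (i < n)%N -> coordinate t i =
        if (i <= m)%N then - coordinate s i else coordinate s i.
      exact: (@coordinate_negate (fun i => (i <= m)%N)).
    have tl i : line t i = -1 * line s i.
      apply: (@polar_facet _ _ _ _ _ j) => //; first exact: facet_coordinateN fs.
      by move=> l lj; rewrite ct ?ifT ?mulN1r//; lia.
    (* The compensating parameter has index [m]: it is the radius if [k = 0], and otherwise the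
       first radial parameter, whose sign affects only the first radial coordinate. *)
    have [k0|k0] := posnP k.
      apply: (same_fibre_pointI n10 sqN1 tl).
      * by rewrite /radial !polar0// mul1r mulr1.
      * by move=> i i0; rewrite /radial !(@polar_gt _ _ k i) ?mulr0//; lia.
      * by rewrite /radius ct ?ifT ?mulN1r//; lia.
    have t0 : coordinate t (m + 0) = - coordinate s (m + 0).
      by rewrite addn0 ct ?leqnn//; lia.
    apply: (same_fibre_pointI n10 sq1 tl).
    * by rewrite /radial !polar_first// t0 mulrN1 opprK mul1r.
    * move=> i i0; rewrite mul1r; apply: polar_flip_first => // l lk.
      by rewrite ct ?ifN//; lia.
    * by rewrite mul1r /radius ct ?ifN//; lia.
  (* Both numbers exceed [j], so this is a line parameter after [j] with index below [d]. *)
  have en : (minn d.-1 m.-1 < n)%N by lia.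
  left; exists (Ordinal en); split=> [||s fs].
  - by rewrite /=; lia.
  - by rewrite -(inj_eq val_inj) /=; lia.
  set t := erase _ s.
  have ct i : (i < n)%N -> i != minn d.-1 m.-1 -> coordinate t i = coordinate s i.
    exact: (@coordinate_erase (Ordinal en) s i).
  apply: (@same_fibre_pointI _ _ 1 1) => //; rewrite ?oner_eq0//.
  + move=> i; apply: (@polar_facet _ _ _ _ _ j) => //.
      exact: facet_coordinateN fs.
    by move=> l lj; rewrite mul1r ct//; lia.
  + by rewrite mulr1 mul1r; apply: eq_polar => l lk; rewrite ct//; lia.
  + by move=> i _; rewrite mul1r; apply: eq_polar => l lk; rewrite ct//; lia.
  + by rewrite mul1r /radius ct//; lia.
case: (ltngtP j.+1 (m + k)) => [jmk|mkj|jmk].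
- have en : (minn d.-1 (m + k).-1 < n)%N by lia.
  left; exists (Ordinal en); split=> [||s fs].
  + by rewrite /=; lia.
  + by rewrite -(inj_eq val_inj) /=; lia.
  set t := erase _ s.
  have ct i : (i < n)%N -> i != minn d.-1 (m + k).-1 -> coordinate t i = coordinate s i.
    exact: (@coordinate_erase (Ordinal en) s i).
  have tr i : radial t i = 1 * radial s i.
    apply: (@polar_facet _ _ _ _ _ (j - m)) => //.
    * lia.
    * by rewrite subnKC//; exact: facet_coordinateN fs.
    * by move=> l lj; rewrite mul1r ct//; lia.
  apply: (@same_fibre_pointI _ _ 1 1) => //; rewrite ?oner_eq0 ?mulr1//.
  + by move=> i; rewrite mul1r; apply: eq_polar => l lm; rewrite ct//; lia.
  + by rewrite mul1r /radius ct//; lia.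
- by lia.
- right; exists (fun i : 'I_n => (m <= i)%N); split=> [|i im|s fs].
  + by [].
  + have i_n : (i < (m + k).+1)%N := ltn_ord i; lia.
  set t := negate _ s.
  have ct i : (i < n)%N -> coordinate t i =
      if (m <= i)%N then - coordinate s i else coordinate s i.
    exact: (@coordinate_negate (fun i => (m <= i)%N)).
  have tr i : radial t i = -1 * radial s i.
    apply: (@polar_facet _ _ _ _ _ (j - m)) => //.
    * lia.
    * by rewrite subnKC//; exact: facet_coordinateN fs.
    * by move=> l lj; rewrite ct ?ifT ?mulN1r//; lia.
  apply: (@same_fibre_pointI _ _ 1 (-1)) => //; rewrite ?oner_eq0 ?mulr1//.
  + by move=> i; rewrite mul1r; apply: eq_polar => l lm; rewrite ct ?ifN//; lia.
  + by rewrite mulN1r /radius ct ?leq_addr.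
Qed.

End Symmetries.

(** * The equidistant point *)

Section Equidistance.
Context {R : realType} {m k : nat}.
Let n := (m + k).+1.
Let G := grassmannian R n k.+1.
Context (N : G -> 'rV[R]_n -> R) (V : 'I_n.+1 -> set (G * 'rV[R]_n)).
Hypothesis N_norm : forall L, norm_on (subspace_of L) (N L).
Hypothesis N_smooth :
  forall L, smooth_body (subspace_of L) (unit_ball (subspace_of L) (N L)).
Hypothesis N_continuous : {within canonical_bundle, continuous (fun p => N p.1 p.2)}.
Hypothesis V_sub : forall i, V i `<=` canonical_bundle.
Hypothesis V_compact : forall i, compact (V i).
Hypothesis V_nonempty : forall i L, fiber_over (V i) L !=set0.
Hypothesis V_continuous : forall i L0,
  hausdorff_dist (fiber_over (V i) L) (fiber_over (V i) L0) @[L --> L0] --> 0.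
Hypothesis V_non_antipodal :
  forall L : G, non_antipodal (subspace_of L) (fun i => fiber_over (V i) L).

Let D (l : 'I_n.+1) (L : G) x := fiber_dist N V l L x.

Lemma asymptotic_cube : exists r0 : R, forall s, cube s -> exists i j, forall r, r0 <= r ->
  D i (family_gr s) (r *: point s) < D j (family_gr s) (r *: point s) /\
  D j (family_gr s) (- (r *: point s)) < D i (family_gr s) (- (r *: point s)).
Proof.
pose Q (r0 : R) s := exists i j, forall r, r0 <= r ->
  D i (family_gr s) (r *: point s) < D j (family_gr s) (r *: point s) /\
  D j (family_gr s) (- (r *: point s)) < D i (family_gr s) (- (r *: point s)).
suff /filter_ex[r0 hr0] : \forall r0 \near +oo, cube `<=` Q r0 by exists r0.
have /compact_near_coveringP := @compact_cube R n.
apply => s cs.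
have [i [j [b near_b]]] := asymptotic_near N_norm N_smooth N_continuous V_sub
  V_compact V_nonempty V_continuous V_non_antipodal (@continuous_family_gr R m k)
  (@continuous_point R m k) (@point_family R m k) (point_neq0 s).
exists ([set t | forall r, b <= r ->
    D i (family_gr t) (r *: point t) < D j (family_gr t) (r *: point t) /\
    D j (family_gr t) (- (r *: point t)) < D i (family_gr t) (- (r *: point t))],
  [set r0 | b <= r0]).
  by split=> //=; apply: nbhs_pinfty_ge; exact: num_real.
move=> [t r0] /= [ht br0]; exists i, j => r r0r.
by apply: ht; exact: le_trans br0 r0r.
Qed.

Lemma continuous_fiber_dist l (z : 'rV[R]_n -> 'rV[R]_n) :
  continuous z -> (forall s, z s \in subspace_of (family_gr s)) ->
  continuous (fun s => D l (family_gr s) (z s)).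
Proof.
move=> cz zs; apply: continuous_dist_to => //; exact: continuous_family_gr.
Qed.

(* With weight 0 this is the difference of the distances at [x]; with weight
   1/2 it is odd in [x]. *)
Definition skew_difference L x (w : R) (i : 'I_n) : R :=
  (1 - w) * (D (widen_ord (leqnSn n) i) L x - D ord_max L x) -
  w * (D (widen_ord (leqnSn n) i) L (- x) - D ord_max L (- x)).

Lemma skew_difference_odd L x i :
  skew_difference L (- x) (1 / 2) i = - skew_difference L x (1 / 2) i.
Proof.
rewrite /skew_difference (opprK x).
move: (D _ L x) (D ord_max L x) (D _ L (- x)) (D ord_max L (- x)) => a b c d; lra.
Qed.

Lemma skew_difference_eq0 L x w : (forall i, skew_difference L x w i = 0) ->
  forall i j, (1 - w) * D i L x - w * D i L (- x) =
              (1 - w) * D j L x - w * D j L (- x).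
Proof.
move=> h; pose g i := (1 - w) * D i L x - w * D i L (- x).
suff gE i : g i = g ord_max by move=> i j; rewrite -!/(g _) !gE.
have [->//|im] := eqVneq i ord_max.
have i_n : (i < n)%N.
  by rewrite ltn_neqAle -(inj_eq val_inj) in im *; rewrite im -ltnS ltn_ord.
have -> : i = widen_ord (leqnSn n) (Ordinal i_n) by apply: val_inj.
have := h (Ordinal i_n); rewrite /skew_difference /g; lra.
Qed.

Let rad : 'rV[R]_n -> R := @radius R m k.

(** Zero where [|rad s| <= 1/2], so that a zero of the map there is an equidistant point, and [1/2]
    where [|rad s| = 1], so that the map is odd there. *)
Definition weight s : R := Num.max 0 (`|rad s| - 1 / 2).

Lemma equidistant_point : exists (L : G) (x : 'rV[R]_n), x \in subspace_of L /\
  forall i j, D i L x = D j L x.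
Proof.
apply: contrapT => noequi.
have [r0 hr0] := asymptotic_cube.
(* The factor 2 gives [rho * |rad s| >= r0] as soon as [|rad s| > 1/2]; the maximum with 1 keeps
   [rho] positive. *)
pose rho := 2 * Num.max r0 1.
have rho0 : 0 < rho by rewrite mulr_gt0// lt_max ltr01 orbT.
pose x s : 'rV[R]_n := rho *: @scaled_point R m k s.
have xL s : x s \in subspace_of (family_gr s).
  by rewrite !memvZ//; exact: point_family.
pose F s := skew_difference (family_gr s) (x s) (weight s).
have Fc i : continuous (fun s => F s i).
  have cr : continuous (@radius R m k) := @continuous_coordinate R m k (m + k).
  have cx : continuous x.
    apply: continuous_scale; first exact: cst_continuous.
    by apply: continuous_scale; [exact: cr | exact: continuous_point].
  have cxN : continuous (fun s => - x s) by exact: continuous_opp.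
  have cw : continuous weight.
    apply: continuous_pos_part; apply: continuous_sub; last exact: cst_continuous.
    exact: continuous_norm.
  have cD l : continuous (fun s => D l (family_gr s) (x s)).
    exact: (@continuous_fiber_dist l x cx xL).
  have cDN l : continuous (fun s => D l (family_gr s) (- x s)).
    apply: (@continuous_fiber_dist l (fun s => - x s) cxN) => s.
    by rewrite memvN.
  apply: continuous_sub; apply: continuous_mul.
  - by apply: continuous_sub => //; exact: cst_continuous.
  - exact: continuous_sub.
  - exact: cw.
  - exact: continuous_sub.
have [||s cs Fs] := @cube_zero R n F isT Fc.
- move=> j; have [P [Pj Pi hP]] := @odd_symmetry R m k j; exists P; split=> // s fs i.
  have [hL hx hr hr'] := hP s fs.
  have w2 : 1 - 1 / 2 = 1 / 2 :> R by field.
  rewrite /F /weight /rad hL hr hr' /x hx scalerN w2.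
  rewrite (_ : Num.max 0 (1 / 2) = 1 / 2 :> R); last by apply/max_idPr.
  exact: skew_difference_odd.
- move=> d j dj; have sameF s t : @same_fibre_point R m k s t -> F t = F s.
    by move=> [hL hx hr]; rewrite /F /weight /rad hL hr /x hx.
  have [[e [ed ej he]]|[P [Pj Pi hP]]] := @facet_symmetry R m k d j dj; [left|right].
    by exists e; split=> [//|//|s fs]; exact: (sameF _ _ (he s fs)).
  by exists P; split=> [//|//|s fs]; exact: (sameF _ _ (hP s fs)).
have eqg := skew_difference_eq0 Fs.
have rs : `|rad s| <= 1.
  by have := cs (inord (m + k)); rewrite in_itv /= -ler_norml.
have [w0|w0] := lerP `|rad s| (1 / 2).
  apply: noequi; exists (family_gr s), (x s); split=> // i j.
  have := eqg i j; rewrite (_ : weight s = 0) ?subr0 ?mul1r ?mul0r ?subr0//.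
  by apply/max_idPl; rewrite subr_le0.
have wE : weight s = `|rad s| - 1 / 2 by apply/max_idPr; rewrite subr_ge0 ltW.
(* Here the weight [w] is positive and at most [1/2]. The differences of the distances for [i] and
   [j] have opposite signs at the point and at its opposite, so [1 - w] times the first is not [w]
   times the second. *)
have [i [j hij]] := hr0 s cs.
have := hij (rho * `|rad s|).
have -> : r0 <= rho * `|rad s|.
  have r0m : r0 <= Num.max r0 1 by rewrite le_max lexx.
  have m1 : 1 <= Num.max r0 1 by rewrite le_max lexx orbT.
  by apply: le_trans r0m _; rewrite /rho; nra.
move=> /(_ isT); have := eqg i j; rewrite wE /x /scaled_point -/rad !scalerA.
have [r_ge0|r_lt0] := lerP 0 (rad s).
  rewrite ger0_norm// in rs w0 *.
  set y := _ *: point s; move: (D i _ y) (D j _ y) (D i _ (- y)) (D j _ (- y)).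
  move=> a b a' b'; nra.
(* A negative radius exchanges the point and its opposite. *)
rewrite ltr0_norm// in rs w0 *; rewrite [rho * - rad s]mulrN scaleNr (opprK (_ *: _)).
set y := _ *: point s; move: (D i _ y) (D j _ y) (D i _ (- y)) (D j _ (- y)).
move=> a b a' b'; nra.
Qed.

End Equidistance.

Theorem theorem2p8 (R : realType) (n k : nat) (hkn : (1 <= k <= n)%N)
  (N : grassmannian R n k -> 'rV[R]_n -> R)
  (N_norm : forall L, norm_on (subspace_of L) (N L))
  (N_smooth : forall L, smooth_body (subspace_of L) (unit_ball (subspace_of L) (N L)))
  (N_continuous :
    {within canonical_bundle, continuous (fun p => N p.1 p.2)})
  (V : 'I_n.+1 -> set (grassmannian R n k * 'rV[R]_n))
  (V_sub : forall i, V i `<=` canonical_bundle)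
  (V_compact : forall i, compact (V i))
  (V_nonempty : forall i L, fiber_over (V i) L !=set0)
  (V_continuous : forall i L0,
    hausdorff_dist (fiber_over (V i) L) (fiber_over (V i) L0) @[L --> L0] --> 0)
  (V_non_antipodal : forall L : grassmannian R n k,
    non_antipodal (subspace_of L) (fun i => fiber_over (V i) L)) :
  exists (L : grassmannian R n k) (x : 'rV[R]_n), x \in subspace_of L /\
    forall i j, dist_to (N L) x (fiber_over (V i) L)
              = dist_to (N L) x (fiber_over (V j) L).
Proof.
(* Here [m = n - k] is the dimension of the projective space of the [k]-spaces through a fixed
   [(k - 1)]-space, and [l = k - 1]. *)
have [m [l [nE kE]]] : exists m l, n = (m + l).+1 /\ k = l.+1.
  by exists (n - k)%N, k.-1; lia.
by subst n k; exact: equidistant_point.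
Qed.
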